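(* Let $\Bbbk$ be a field of characteristic $0$, let $K$ be the $8$-vertex simplicial complex on $[8]=\{1,\dots,8\}$ with Stanley-Reisner ideal $$I_K=(x_1x_2,\ x_1x_3x_4x_5,\ x_3x_4x_5x_6,\ x_3x_5x_6x_7,\ x_7x_8),$$ and let $\widehat{K}=\mathrm{Bier}(K)$, a $16$-vertex triangulation of $S^6$. The manifold $\mathcal{Z}_{\widehat{K}}$ carries an indecomposable Massey triple product $\langle\alpha,\beta,\gamma\rangle\in H^{12}(\mathcal{Z}_{\widehat{K}},\Bbbk)$.
   Context: The Stanley-Reisner ideal $I_K\subset\Bbbk[x_1,\dots,x_n]$ of a simplicial complex $K$ on $[n]$ is generated by the monomials $\prod_{i\in\sigma}x_i$ for $\sigma\notin K$; so $\sigma\subseteq[8]$ is a simplex of the present $K$ iff $\prod_{i\in\sigma}x_i\notin I_K$. For a simplicial complex $K$ on $[n]$ (not the full simplex), the combinatorial Alexander dual $K^\star$ is the simplicial complex whose simplices are the complements in $[n]$ of the non-simplices of $K$. The Bier sphere is the deleted join $\mathrm{Bier}(K)=\{\sigma*\tau\in K*K^\star:\sigma\cap\tau=\emptyset\}$, where the join is taken with disjoint copies of the vertex set $[n]$ for $K$ and $K^\star$ and $\sigma\cap\tau$ is computed by viewing both as subsets of $[n]$; it is a triangulation of $S^{n-2}$ on (up to) $2n$ vertices. For a simplicial complex $K$ on vertex set $[n]$, the moment-angle complex is $\mathcal{Z}_K=\bigcup_{\sigma\in K}\{z\in (D^2)^{\times n}: |z_i|=1 \text{ for } i\notin\sigma\}$,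 where $D^2\subset\mathbb{C}$ is the closed unit disk; it is a manifold when $K$ triangulates a sphere. Massey products in $H^*(\mathcal{Z}_K,\Bbbk)$ are computed from the cellular cochain algebra $C^*_{\mathrm{cw}}(\mathcal{Z}_K,\Bbbk)=\big((S/I_K)\otimes_\Bbbk E\big)/(x_i^2,\ x_iu_i)$, a commutative differential graded algebra whose cohomology is $H^*(\mathcal{Z}_K,\Bbbk)$. Here $S=\Bbbk[x_1,\dots,x_n]$ with $\deg x_i=2$, $E$ is the exterior algebra on $u_1,\dots,u_n$ with $\deg u_i=1$, and $du_i=x_i$, $dx_i=0$. Let $(A,d)$ be a differential graded algebra with graded-commutative cohomology, and let $\alpha_1,\alpha_2,\alpha_3\in H^*(A)$ be homogeneous with $\alpha_1\alpha_2=\alpha_2\alpha_3=0$. Pick cocycles $a_i$ representing $\alpha_i$ and $x,y\in A$ with $dx=a_1a_2$, $dy=a_2a_3$; then $xa_3-\bar a_1y$ is a cocycle, where $\bar a=(-1)^{|a|}a$. The Massey triple product $\langle\alpha_1,\alpha_2,\alpha_3\rangle$ is the set of cohomology classes of all such cocycles. It is decomposable if this set contains a class which is a product $\lambda\nu$ of two elements of $H^{>0}(A)$; otherwise it is indecomposable. *)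

(* Defs.v *)
From HB Require Import structures.
From mathcomp Require Import all_boot all_order all_algebra.
From mathcomp Require Import boolp.
From mathcomp Require Import mpoly ring.

Set Implicit Arguments.
Unset Strict Implicit.
Unset Printing Implicit Defensive.

Import GRing.Theory.
Local Open Scope ring_scope.
Local Open Scope quotient_scope.

HB.mixin Record isTwoSided (R : pzRingType) (I : R -> bool) := {
  bi_mull : forall a x : R, x \in (I : {pred R}) -> a * x \in (I : {pred R});
  bi_mulr : forall x a : R, x \in (I : {pred R}) -> x * a \in (I : {pred R})
}.

#[short(type="biideal")]
HB.structure Definition BiIdeal (R : pzRingType) :=
  {I of GRing.ZmodClosed R I & isTwoSided R I}.

Section GeneratedIdeal.
Variables (R : pzRingType) (G : R -> Prop).

Inductive in_ideal : R -> Prop :=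
| in_ideal0 : in_ideal 0
| in_idealD a g b x : G g -> in_ideal x -> in_ideal (a * g * b + x).

Definition ideal_gen : R -> bool := fun x => `[< in_ideal x >].

Lemma ideal_genP x : reflect (in_ideal x) (x \in (ideal_gen : {pred R})).
Proof. exact: asboolP. Qed.

Lemma in_ideal_add x y : in_ideal x -> in_ideal y -> in_ideal (x + y).
Proof.
elim=> [|a g b z Gg _ IH] Iy; first by rewrite add0r.
by rewrite -addrA; apply: in_idealD => //; exact: IH.
Qed.

Lemma in_ideal_opp x : in_ideal x -> in_ideal (- x).
Proof.
elim=> [|a g b z Gg _ IH]; first by rewrite oppr0; exact: in_ideal0.
by rewrite opprD -!mulNr; exact: in_idealD.
Qed.

Lemma ideal_gen_zmod_closed : zmod_closed (ideal_gen : {pred R}).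
Proof.
split=> [|x y /ideal_genP Ix /ideal_genP Iy]; apply/ideal_genP.
  exact: in_ideal0.
exact: in_ideal_add (in_ideal_opp Iy).
Qed.

Lemma ideal_gen_mull a x : x \in (ideal_gen : {pred R}) ->
  a * x \in (ideal_gen : {pred R}).
Proof.
move/ideal_genP=> Ix; apply/ideal_genP.
elim: Ix => [|c g b z Gg _ IH]; first by rewrite mulr0; exact: in_ideal0.
by rewrite mulrDr !mulrA; exact: in_idealD.
Qed.

Lemma ideal_gen_mulr x a : x \in (ideal_gen : {pred R}) ->
  x * a \in (ideal_gen : {pred R}).
Proof.
move/ideal_genP=> Ix; apply/ideal_genP.
elim: Ix => [|c g b z Gg _ IH]; first by rewrite mul0r; exact: in_ideal0.
by rewrite mulrDl -!mulrA mulrA; exact: in_idealD.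
Qed.

HB.instance Definition _ := GRing.isZmodClosed.Build R ideal_gen
  ideal_gen_zmod_closed.
HB.instance Definition _ := isTwoSided.Build R ideal_gen
  ideal_gen_mull ideal_gen_mulr.

Lemma ideal_gen_sub g : G g -> g \in (ideal_gen : {pred R}).
Proof.
move=> Gg; apply/ideal_genP; rewrite -[g]addr0 -[g]mul1r -[1 * g]mulr1.
by apply: in_idealD => //; exact: in_ideal0.
Qed.

End GeneratedIdeal.

(* The library's [{ideal_quot I}] is restricted to commutative rings. *)
Section RingQuotient.
Variables (R : pzRingType) (I : biideal R).

Definition ring_quot : Type := Quotient.quot I.
HB.instance Definition _ := GRing.Zmodule.on ring_quot.
HB.instance Definition _ := EqQuotient.on ring_quot.

Definition quot_pi (x : R) : ring_quot := \pi_(Quotient.quot I) x.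

Lemma quot_piP x y : reflect (quot_pi x = quot_pi y) (x - y \in (I : {pred R})).
Proof. by rewrite Quotient.idealrBE; exact: eqP. Qed.

Lemma quot_pi_surj q : {x | quot_pi x = q}.
Proof. by exists (repr q); exact: reprK. Qed.

Lemma quot_pi_zmod_morphism : zmod_morphism quot_pi.
Proof. by move=> x y; rewrite /quot_pi raddfB. Qed.
HB.instance Definition _ := GRing.isZmodMorphism.Build R ring_quot quot_pi
  quot_pi_zmod_morphism.

Definition quot_one : ring_quot := quot_pi 1.
Definition quot_mul (p q : ring_quot) : ring_quot :=
  quot_pi (sval (quot_pi_surj p) * sval (quot_pi_surj q)).

Lemma quot_mulE x y : quot_mul (quot_pi x) (quot_pi y) = quot_pi (x * y).
Proof.
rewrite /quot_mul; case: quot_pi_surj => x' /= /quot_piP xx'.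
case: quot_pi_surj => y' /= /quot_piP yy'; apply/quot_piP.
rewrite -[x' * y'](subrK (x' * y)) -mulrBr -addrA -mulrBl.
by apply: rpredD; [exact: bi_mull | exact: bi_mulr].
Qed.

Lemma quot_mulA : associative quot_mul.
Proof.
move=> p q r; case: (quot_pi_surj p) (quot_pi_surj q) (quot_pi_surj r).
by move=> x <- [y <-] [z <-]; rewrite !quot_mulE mulrA.
Qed.

Lemma quot_mul1q : left_id quot_one quot_mul.
Proof. by move=> p; case: (quot_pi_surj p) => x <-; rewrite quot_mulE mul1r. Qed.

Lemma quot_mulq1 : right_id quot_one quot_mul.
Proof. by move=> p; case: (quot_pi_surj p) => x <-; rewrite quot_mulE mulr1. Qed.

Lemma quot_mulDl : left_distributive quot_mul +%R.
Proof.
move=> p q r; case: (quot_pi_surj p) (quot_pi_surj q) (quot_pi_surj r).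
move=> x <- [y <-] [z <-].
by rewrite -raddfD !quot_mulE mulrDl raddfD.
Qed.

Lemma quot_mulDr : right_distributive quot_mul +%R.
Proof.
move=> p q r; case: (quot_pi_surj p) (quot_pi_surj q) (quot_pi_surj r).
move=> x <- [y <-] [z <-].
by rewrite -raddfD !quot_mulE mulrDr raddfD.
Qed.

HB.instance Definition _ := GRing.Zmodule_isPzRing.Build ring_quot
  quot_mulA quot_mul1q quot_mulq1 quot_mulDl quot_mulDr.

Lemma quot_pi_monoid_morphism : monoid_morphism quot_pi.
Proof. by split=> // x y; rewrite -quot_mulE. Qed.
HB.instance Definition _ := GRing.isMonoidMorphism.Build R ring_quot quot_pi
  quot_pi_monoid_morphism.

End RingQuotient.

Section GradedSum.
Variable (V : zmodType).

Definition graded_sum (hom : nat -> V -> Prop) (x : V) : Prop :=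
  exists (n : nat) (f : nat -> V),
    (forall i, hom i (f i)) /\ x = \sum_(i < n) f i.

Variable hom : nat -> V -> Prop.
Hypothesis hom0 : forall i, hom i 0.
Hypothesis homD : forall i x y, hom i x -> hom i y -> hom i (x + y).

Lemma graded_sum0 : graded_sum hom 0.
Proof. by exists 0, (fun=> 0); split=> //; rewrite big_ord0. Qed.

Lemma graded_sumW n m (f : nat -> V) : (n <= m)%N ->
  \sum_(i < n) f i = \sum_(i < m) (if (i < n)%N then f i else 0).
Proof.
by move=> le_nm; rewrite (big_ord_widen m f le_nm) -big_mkcond.
Qed.

Lemma graded_sumD x y : graded_sum hom x -> graded_sum hom y ->
  graded_sum hom (x + y).
Proof.
move=> [n [f [hf ->]]] [m [g [hg ->]]].
exists (maxn n m), (fun i => (if (i < n)%N then f i else 0) +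
  (if (i < m)%N then g i else 0)); split.
  by move=> i; apply: homD; case: ifP.
rewrite big_split /= -!graded_sumW //; [exact: leq_maxr | exact: leq_maxl].
Qed.

Lemma graded_sum1 i x : hom i x -> graded_sum hom x.
Proof.
move=> hx; exists i.+1, (fun j => if j == i then x else 0); split.
  by move=> j; case: eqP => [->|].
rewrite big_ord_recr /= eqxx big1 ?add0r // => j _.
by rewrite ltn_eqF.
Qed.

Lemma graded_sum_big (T : Type) (s : seq T) (P : pred T) (F : T -> V) :
  (forall t, P t -> graded_sum hom (F t)) ->
  graded_sum hom (\sum_(t <- s | P t) F t).
Proof. by move=> hF; apply: big_ind => //; [exact: graded_sum0 | exact: graded_sumD]. Qed.

End GradedSum.

(* Scalars are left out: they play no role in the definition of cohomology
   classes, of their products or of Massey products. *)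
Record dga := Dga {
  dga_ring :> pzRingType;
  diff : {additive dga_ring -> dga_ring};
  hom : nat -> dga_ring -> Prop;
  hom0 : forall i, hom i 0;
  homB : forall i a b, hom i a -> hom i b -> hom i (a - b);
  hom_split : forall a, graded_sum hom a;
  hom_direct : forall n (f : nat -> dga_ring), (forall i, hom i (f i)) ->
    \sum_(i < n) f i = 0 -> forall i, (i < n)%N -> f i = 0;
  hom1 : hom 0 1;
  homM : forall i j a b, hom i a -> hom j b -> hom (i + j) (a * b);
  hom_diff : forall i a, hom i a -> hom i.+1 (diff a);
  diffK : forall a, diff (diff a) = 0;
  diffM : forall i a b, hom i a ->
    diff (a * b) = diff a * b + (-1) ^+ i * a * diff b
}.

Section Cohomology.
Variable A : dga.

Lemma homN i (a : A) : hom i a -> hom i (- a).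
Proof. by rewrite -[- a]add0r => ha; apply: homB => //; exact: hom0. Qed.

Lemma homD i (a b : A) : hom i a -> hom i b -> hom i (a + b).
Proof. by move=> ha /homN hb; rewrite -[b]opprK; exact: homB. Qed.

Lemma hom_sign i k (a : A) : hom i a -> hom i ((-1) ^+ k * a).
Proof. by rewrite -signr_odd mulr_sign; case: ifP => // _; exact: homN. Qed.

Lemma diff_sign k (a : A) : diff A ((-1) ^+ k * a) = (-1) ^+ k * diff A a.
Proof. by rewrite -signr_odd !mulr_sign; case: ifP => // _; rewrite raddfN. Qed.

Lemma sign_signK k (a : A) : (-1) ^+ k * ((-1) ^+ k * a) = a.
Proof. by rewrite mulrA -expr2 sqrr_sign mul1r. Qed.

Lemma hom_eq n (f g : nat -> A) : (forall i, hom i (f i)) ->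
    (forall i, hom i (g i)) -> \sum_(i < n) f i = \sum_(i < n) g i ->
  forall i, (i < n)%N -> f i = g i.
Proof.
move=> hf hg eq_fg i lt_in; apply/eqP; rewrite -subr_eq0; apply/eqP.
apply: (@hom_direct A n (fun i => f i - g i)) => // [j|].
  exact: homB.
by rewrite sumrB eq_fg subrr.
Qed.

Definition cocycle : A -> bool := fun a => diff A a == 0.

Lemma diff1 : diff A 1 = 0.
Proof.
have := diffM 1 (hom1 A); rewrite expr0 !mul1r mulr1 => /eqP.
by rewrite -subr_eq subrr eq_sym => /eqP.
Qed.

Lemma diff_sum_eq0 n (f : nat -> A) : (forall i, hom i (f i)) ->
  diff A (\sum_(i < n) f i) = 0 -> forall i, (i < n)%N -> diff A (f i) = 0.
Proof.
move=> hf; rewrite raddf_sum => eq0 i lt_in.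
pose g i := if i is j.+1 then diff A (f j) else 0.
have hg j : hom j (g j) by case: j => [|j] /=; [exact: hom0 | exact: hom_diff].
apply: (@hom_direct A n.+1 g hg _ i.+1) => //.
by rewrite big_ord_recl /= add0r.
Qed.

Lemma cocycleM a b : diff A a = 0 -> diff A b = 0 -> diff A (a * b) = 0.
Proof.
have [n [f [hf ->]]] := hom_split a; move=> /(diff_sum_eq0 hf) f0 b0.
rewrite mulr_suml raddf_sum big1 // => i _.
by rewrite (diffM _ (hf i)) f0 // b0 mul0r mulr0 addr0.
Qed.

Lemma cocycle_subring_closed : subring_closed (cocycle : {pred A}).
Proof.
split=> [|a b /eqP a0 /eqP b0|a b /eqP a0 /eqP b0]; apply/eqP.
- exact: diff1.
- by rewrite raddfB /= a0 b0 subrr.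
- exact: cocycleM.
Qed.

HB.instance Definition _ := GRing.isSubringClosed.Build A cocycle
  cocycle_subring_closed.

Record cocycles := Cocycles { cocycle_val : A; cocycle_valP : cocycle cocycle_val }.
HB.instance Definition _ := [isSub for cocycle_val].
HB.instance Definition _ := [Choice of cocycles by <:].
HB.instance Definition _ := GRing.SubChoice_isSubPzRing.Build A cocycle cocycles
  cocycle_subring_closed.

Lemma cocycle_valM (y z : cocycles) :
  cocycle_val (y * z) = cocycle_val y * cocycle_val z.
Proof. exact: (rmorphM (val : cocycles -> A)). Qed.

Lemma cocycle_val0 : cocycle_val 0 = 0.
Proof. exact: (rmorph0 (val : cocycles -> A)). Qed.

Lemma cocycle_valB (y z : cocycles) :
  cocycle_val (y - z) = cocycle_val y - cocycle_val z.
Proof. exact: (rmorphB (val : cocycles -> A)). Qed.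

Lemma cocyclesE (z : cocycles) : diff A (cocycle_val z) = 0.
Proof. exact/eqP/cocycle_valP. Qed.

Definition coboundary : cocycles -> bool :=
  fun z => `[< exists b, cocycle_val z = diff A b >].

Lemma coboundaryP z :
  reflect (exists b, cocycle_val z = diff A b) (z \in (coboundary : {pred _})).
Proof. exact: asboolP. Qed.

Lemma coboundary_zmod_closed : zmod_closed (coboundary : {pred cocycles}).
Proof.
split=> [|x y /coboundaryP[a xE] /coboundaryP[b yE]]; apply/coboundaryP.
  by exists 0; rewrite cocycle_val0 raddf0.
by exists (a - b); rewrite cocycle_valB raddfB /= xE yE.
Qed.

Lemma coboundary_mull (z x : cocycles) : x \in (coboundary : {pred _}) ->
  z * x \in (coboundary : {pred _}).
Proof.
move=> /coboundaryP[b xE]; apply/coboundaryP.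
rewrite cocycle_valM xE.
have [n [f [hf zE]]] := hom_split (cocycle_val z).
have f0 i : (i < n)%N -> diff A (f i) = 0.
  by apply: (diff_sum_eq0 hf); rewrite -zE cocyclesE.
exists (\sum_(i < n) (-1) ^+ i * f i * b).
rewrite raddf_sum zE mulr_suml; apply: eq_bigr => i _.
have hi := hom_sign i (hf i).
by rewrite /= (diffM _ hi) diff_sign f0 // mulr0 mul0r add0r -!mulrA sign_signK.
Qed.

Lemma coboundary_mulr (x z : cocycles) : x \in (coboundary : {pred _}) ->
  x * z \in (coboundary : {pred _}).
Proof.
move=> /coboundaryP[b xE]; apply/coboundaryP; exists (b * cocycle_val z).
rewrite cocycle_valM xE; have [n [f [hf ->]]] := hom_split b.
rewrite !(raddf_sum, mulr_suml); apply: eq_bigr => i _.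
by rewrite /= (diffM _ (hf i)) cocyclesE mulr0 addr0.
Qed.

HB.instance Definition _ := GRing.isZmodClosed.Build cocycles coboundary
  coboundary_zmod_closed.
HB.instance Definition _ := isTwoSided.Build cocycles coboundary
  coboundary_mull coboundary_mulr.

Definition coboundaries : biideal cocycles :=
  BiIdeal.clone cocycles coboundary _.

Definition cohomology : pzRingType := ring_quot coboundaries.

Definition coh_class (z : cocycles) : cohomology := quot_pi coboundaries z.

Definition coh_hom (i : nat) (eta : cohomology) : Prop :=
  exists2 z : cocycles, hom i (cocycle_val z) & eta = coh_class z.

Definition coh_pos : cohomology -> Prop :=
  graded_sum (fun i => coh_hom i.+1).

(* The component of degree [i - 1], which is zero when [i = 0]. *)
Definition hom_pred (i : nat) (a : A) : Prop :=
  if i is j.+1 then hom j a else a = 0.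

(* [massey p q r alpha beta gamma] is the Massey triple product of classes of
   degrees [p], [q], [r], as a subset of the cohomology; the degrees are
   explicit because the zero class is homogeneous of every degree. *)
Definition massey (p q r : nat) (alpha beta gamma : cohomology)
    (eta : cohomology) : Prop :=
  exists (a b c : cocycles) (x y : A) (z : cocycles),
    [/\ [/\ hom p (cocycle_val a), hom q (cocycle_val b)
          & hom r (cocycle_val c)],
        [/\ coh_class a = alpha, coh_class b = beta & coh_class c = gamma],
        hom_pred (p + q) x /\ diff A x = cocycle_val a * cocycle_val b,
        hom_pred (q + r) y /\ diff A y = cocycle_val b * cocycle_val c
      & cocycle_val z = x * cocycle_val c - (-1) ^+ p * cocycle_val a * y
        /\ eta = coh_class z].

Definition decomposable (M : cohomology -> Prop) : Prop :=
  exists lambda nu : cohomology,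
    [/\ coh_pos lambda, coh_pos nu & M (lambda * nu)].

Lemma massey_hom p q r alpha beta gamma eta : (0 < p + q)%N ->
  massey p q r alpha beta gamma eta -> coh_hom (p + q + r).-1 eta.
Proof.
move=> pq0 [a [b [c [x [y [z [[ha hb hc] _ [hx _] [hy _] [zE ->]]]]]]]].
exists z => //; rewrite zE; apply: homB.
  case: (p + q)%N pq0 hx => // m _ hx; rewrite addSn /=; exact: homM.
rewrite -mulrA; apply: hom_sign.
rewrite -addnA; case: (q + r)%N hy => [-> | m hy]; first by rewrite mulr0; exact: hom0.
by rewrite addnS; exact: homM.
Qed.

Lemma exact_hom_pred i (b e : A) : hom i b -> diff A e = b ->
  exists2 x, hom_pred i x & diff A x = b.
Proof.
move=> hb; have [n [f [hf ->]]] := hom_split e; rewrite raddf_sum => db.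
pose g j := if j is k.+1 then (if (k < n)%N then diff A (f k) else 0) else 0.
pose h j := if j == i then b else 0.
have hg j : hom j (g j).
  case: j => [|j] /=; first exact: hom0.
  by case: ifP => _; [exact: hom_diff | exact: hom0].
have hh j : hom j (h j) by rewrite /h; case: eqP => [->|_] //; exact: hom0.
have gb m : (n <= m)%N -> \sum_(j < m.+1) g j = b.
  move=> le_nm; rewrite big_ord_recl /= add0r -db.
  by rewrite (graded_sumW (fun j => diff A (f j)) le_nm).
have hbE m : (i <= m)%N -> \sum_(j < m.+1) h j = b.
  move=> le_im; rewrite (bigD1 (Ordinal (le_im : i < m.+1)%N)) //= /h eqxx.
  by rewrite big1 ?addr0 // => j; rewrite -val_eqE /= => /negPf->.
have := @hom_eq (maxn n i).+1 g h hg hh.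
rewrite gb ?leq_maxl // hbE ?leq_maxr // => /(_ erefl i).
rewrite ltnS leq_maxr => /(_ isT); rewrite /h eqxx.
case: i {hb h hh hbE} => [|i] /= gE; first by exists 0; rewrite // raddf0.
case: ifP gE => _ gE; first by exists (f i).
by exists 0; [exact: hom0 | rewrite raddf0].
Qed.

Lemma massey_nonempty p q r alpha beta gamma :
    coh_hom p alpha -> coh_hom q beta -> coh_hom r gamma ->
    alpha * beta = 0 -> beta * gamma = 0 ->
  exists eta, massey p q r alpha beta gamma eta.
Proof.
have prod0 i j (a b : cocycles) : hom i (cocycle_val a) -> hom j (cocycle_val b) ->
    coh_class a * coh_class b = 0 ->
    exists2 x, hom_pred (i + j) x & diff A x = cocycle_val a * cocycle_val b.
  move=> ha hb; rewrite /coh_class -rmorphM -(raddf0 (quot_pi coboundaries)).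
  move=> /quot_piP; rewrite subr0 => /coboundaryP[e].
  rewrite cocycle_valM => /esym.
  exact/exact_hom_pred/homM.
move=> [a ha ->] [b hb ->] [c hc ->] /(prod0 _ _ _ _ ha hb)[x hx dx].
move=> /(prod0 _ _ _ _ hb hc)[y hy dy].
have hsa := hom_sign p ha.
have z0 : cocycle (x * cocycle_val c - (-1) ^+ p * cocycle_val a * y).
  apply/eqP; rewrite raddfB /= (diffM _ hsa) diff_sign cocyclesE mulr0 mul0r add0r dy.
  rewrite -!mulrA sign_signK mulrA.
  suff -> : diff A (x * cocycle_val c) = diff A x * cocycle_val c by rewrite dx subrr.
  case: (p + q)%N hx => [->|k hx]; first by rewrite mul0r raddf0 mul0r.
  by rewrite (diffM _ hx) cocyclesE mulr0 addr0.
exists (coh_class (Cocycles z0)), a, b, c, x, y, (Cocycles z0).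
by split=> //; split.
Qed.

End Cohomology.

Section ExteriorAlgebra.
Variables (R : comNzRingType) (n : nat).

(* [f A] is the coefficient in [f] of the product, in increasing order, of the
   generators indexed by [A]. *)
Definition ext : Type := {ffun {set 'I_n} -> R}.
HB.instance Definition _ := GRing.Zmodule.on ext.

Implicit Types (A B C D : {set 'I_n}) (f g h : ext) (i j : 'I_n) (c : R).

Definition inversions A B : nat := (\sum_(i in A) \sum_(j in B) (j < i))%N.

(* The sign [s] such that [u_A * u_B = s * u_(A :|: B)]. *)
Definition ext_sign A B : R :=
  if [disjoint A & B] then (-1) ^+ inversions A B else 0.

Definition ext_basis A : ext := [ffun B => (B == A)%:R].
Definition ext_const c : ext := [ffun B => if B == set0 then c else 0].
Definition ext_gen i : ext := ext_basis [set i].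

Definition ext_one : ext := ext_basis set0.
Definition ext_mul f g : ext :=
  [ffun C => \sum_A \sum_(B | A :|: B == C) ext_sign A B * (f A * g B)].

Lemma inversions0l B : inversions set0 B = 0.
Proof. by rewrite /inversions big_set0. Qed.

Lemma inversions0r A : inversions A set0 = 0.
Proof. by rewrite /inversions big1 // => i _; rewrite big_set0. Qed.

Lemma ext_sign0l B : ext_sign set0 B = 1.
Proof. by rewrite /ext_sign inversions0l -setI_eq0 set0I eqxx. Qed.

Lemma ext_sign0r A : ext_sign A set0 = 1.
Proof. by rewrite /ext_sign inversions0r -setI_eq0 setI0 eqxx. Qed.

Lemma sum_disjointU A B (F : 'I_n -> nat) : [disjoint A & B] ->
  (\sum_(i in A :|: B) F i = \sum_(i in A) F i + \sum_(i in B) F i)%N.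
Proof.
move=> dAB; rewrite (eq_bigl [predU A & B]) => [|i]; last by rewrite !inE.
exact: bigU.
Qed.

Lemma inversionsUl A B C : [disjoint A & B] ->
  inversions (A :|: B) C = (inversions A C + inversions B C)%N.
Proof. by move=> dAB; rewrite /inversions sum_disjointU. Qed.

Lemma inversionsUr A B C : [disjoint B & C] ->
  inversions A (B :|: C) = (inversions A B + inversions A C)%N.
Proof.
by move=> dBC; rewrite /inversions -big_split /=; apply: eq_bigr => i _; rewrite sum_disjointU.
Qed.

Lemma disjointUl A B C : [disjoint A :|: B & C] = [disjoint A & C] && [disjoint B & C].
Proof. by rewrite -!setI_eq0 setIUl setU_eq0. Qed.

Lemma disjointUr A B C : [disjoint A & B :|: C] = [disjoint A & B] && [disjoint A & C].
Proof. by rewrite -!setI_eq0 setIUr setU_eq0. Qed.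

Lemma ext_signUl A B C : [disjoint A & B] ->
  ext_sign (A :|: B) C = ext_sign A C * ext_sign B C.
Proof.
move=> dAB; rewrite /ext_sign disjointUl inversionsUl //.
by do 2![case: [disjoint _ & C]]; rewrite /= ?mul0r ?mulr0 // exprD.
Qed.

Lemma ext_signUr A B C : [disjoint B & C] ->
  ext_sign A (B :|: C) = ext_sign A B * ext_sign A C.
Proof.
move=> dBC; rewrite /ext_sign disjointUr inversionsUr //.
by case: [disjoint A & B]; case: [disjoint A & C]; rewrite /= ?mul0r ?mulr0 // exprD.
Qed.

Lemma ext_sign_cocycle A B C :
  ext_sign A B * ext_sign (A :|: B) C = ext_sign B C * ext_sign A (B :|: C).
Proof.
have [dAB|nAB] := boolP [disjoint A & B]; last first.
  rewrite {1}/ext_sign (negPf nAB) mul0r.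
  by rewrite {2}/ext_sign disjointUr (negPf nAB) mulr0.
have [dBC|nBC] := boolP [disjoint B & C]; last first.
  rewrite {3}/ext_sign (negPf nBC) mul0r.
  by rewrite {2}/ext_sign disjointUl (negPf nBC) andbF mulr0.
by rewrite ext_signUl // ext_signUr // mulrCA mulrC mulrAC mulrC.
Qed.

Lemma ext_mulE f g C :
  ext_mul f g C =
  \sum_A \sum_B (A :|: B == C)%:R * (ext_sign A B * (f A * g B)).
Proof.
rewrite ffunE; apply: eq_bigr => A _; rewrite big_mkcond /=; apply: eq_bigr => B _.
by case: ifP; rewrite ?mul1r ?mul0r.
Qed.

Lemma sum_delta (F : {set 'I_n} -> R) A : \sum_B (A == B)%:R * F B = F A.
Proof.
rewrite (bigD1 A) //= eqxx mul1r big1 ?addr0 // => B.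
by rewrite eq_sym => /negPf->; rewrite mul0r.
Qed.

Lemma ext_mulA : associative ext_mul.
Proof.
move=> f g h; apply/ffunP=> D; rewrite !ext_mulE.
transitivity (\sum_A \sum_B \sum_C (A :|: (B :|: C) == D)%:R *
    (ext_sign B C * ext_sign A (B :|: C) * (f A * (g B * h C)))).
  apply: eq_bigr => A _.
  under eq_bigr => X _ do rewrite ext_mulE !mulr_sumr.
  rewrite exchange_big /=; apply: eq_bigr => B _.
  under eq_bigr => X _ do rewrite !mulr_sumr.
  rewrite exchange_big /=; apply: eq_bigr => C _.
  rewrite -(sum_delta (fun X => (A :|: X == D)%:R *
    (ext_sign B C * ext_sign A X * (f A * (g B * h C)))) (B :|: C)).
  by apply: eq_bigr => X _; ring.
rewrite [RHS]exchange_big /=.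
under [RHS]eq_bigr => C _.
  under eq_bigr => X _ do rewrite ext_mulE mulr_suml !mulr_sumr.
  rewrite exchange_big /=.
  under eq_bigr => A _.
    under eq_bigr => X _ do rewrite mulr_suml !mulr_sumr.
    rewrite exchange_big /=.
    over.
  over.
rewrite [RHS]exchange_big /=; apply: eq_bigr => A _.
rewrite [RHS]exchange_big /=; apply: eq_bigr => B _; apply: eq_bigr => C _.
rewrite -ext_sign_cocycle setUA.
rewrite -(sum_delta (fun X => (X :|: C == D)%:R *
  (ext_sign A B * ext_sign X C * (f A * (g B * h C)))) (A :|: B)).
by apply: eq_bigr => X _; ring.
Qed.

Lemma ext_const_mul c f A : ext_mul (ext_const c) f A = c * f A.
Proof.
rewrite ext_mulE (bigD1 set0) //= [X in _ + X]big1 ?addr0; last first.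
  by move=> B /negPf B0; rewrite big1 // => C _; rewrite ffunE B0 mul0r !mulr0.
rewrite -(sum_delta (fun B => c * f B)); apply: eq_bigr => B _.
by rewrite ffunE eqxx set0U ext_sign0l mul1r eq_sym.
Qed.

Lemma ext_one_const : ext_one = ext_const 1.
Proof. by apply/ffunP=> A; rewrite !ffunE; case: eqP. Qed.

Lemma ext_mul1f : left_id ext_one ext_mul.
Proof. by move=> f; apply/ffunP=> A; rewrite ext_one_const ext_const_mul mul1r. Qed.

Lemma ext_mulf1 : right_id ext_one ext_mul.
Proof.
move=> f; apply/ffunP=> C; rewrite ext_mulE -[RHS](sum_delta f) exchange_big /=.
rewrite (bigD1 set0) //= [X in _ + X]big1 ?addr0; last first.
  by move=> B /negPf B0; rewrite big1 // => A _; rewrite ffunE B0 !mulr0.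
by apply: eq_bigr => A _; rewrite ffunE eqxx setU0 ext_sign0r mul1r mulr1 eq_sym.
Qed.

Lemma ext_mulDl : left_distributive ext_mul +%R.
Proof.
move=> f g h; apply/ffunP=> C; rewrite [RHS]ffunE !ext_mulE -big_split /=.
apply: eq_bigr => A _; rewrite -big_split /=; apply: eq_bigr => B _.
by rewrite ffunE; ring.
Qed.

Lemma ext_mulDr : right_distributive ext_mul +%R.
Proof.
move=> f g h; apply/ffunP=> C; rewrite [RHS]ffunE !ext_mulE -big_split /=.
apply: eq_bigr => A _; rewrite -big_split /=; apply: eq_bigr => B _.
by rewrite ffunE; ring.
Qed.

HB.instance Definition _ := GRing.Zmodule_isPzRing.Build ext
  ext_mulA ext_mul1f ext_mulf1 ext_mulDl ext_mulDr.

Lemma ext_constM c f A : (ext_const c * f) A = c * f A.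
Proof. exact: ext_const_mul. Qed.

Lemma ext_genM i f A :
  (ext_gen i * f) A =
  if i \in A then ext_sign [set i] (A :\ i) * f (A :\ i) else 0.
Proof.
rewrite [LHS]ext_mulE (bigD1 [set i]) //= [X in _ + X]big1 ?addr0; last first.
  by move=> B /negPf B0; rewrite big1 // => C _; rewrite ffunE B0 mul0r !mulr0.
under eq_bigr => B _ do rewrite ffunE eqxx mul1r.
case: ifPn => iA.
  rewrite (bigD1 (A :\ i)) //= setD1K // eqxx mul1r [X in _ + X]big1 ?addr0 //.
  move=> B neqB; case: eqP => [defA | _]; last by rewrite mul0r.
  rewrite /ext_sign disjoints1; case: ifP; rewrite ?mul0r ?mulr0 // => iB.
  by rewrite -defA setU1K ?iB ?eqxx in neqB.
rewrite big1 // => B _; case: eqP => [defA | _]; last by rewrite mul0r.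
by rewrite -defA setU11 in iA.
Qed.

Lemma ext_ind (P : ext -> Prop) :
    P 1 -> P 0 -> (forall f g, P f -> P g -> P (f + g)) ->
    (forall c f, P f -> P (ext_const c * f)) ->
    (forall i f, P f -> P (ext_gen i * f)) ->
  forall f, P f.
Proof.
move=> P1 P0 PD Pc Pg f.
have Pb A : P (ext_basis A).
  have [m] := ubnP #|A|; elim: m A => // m IH A /ltnSE leAm.
  have [->|[i iA]] := set_0Vmem A; first exact: P1.
  have: P (ext_const (ext_sign [set i] (A :\ i)) * (ext_gen i * ext_basis (A :\ i))).
    by apply/Pc/Pg/IH; rewrite (cardsD1 i A) iA in leAm.
  congr P; apply/ffunP=> B; rewrite ext_constM ext_genM !ffunE.
  have [iB|iB] := boolP (i \in B); last first.
    by rewrite mulr0; case: eqP => // defB; rewrite defB iA in iB.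
  have -> : (B :\ i == A :\ i) = (B == A).
    by apply/eqP/eqP=> [e|->//]; rewrite -(setD1K iB) e setD1K.
  case: eqP => [-> | _]; last by rewrite !mulr0.
  rewrite mulr1 /ext_sign disjoints1 !inE eqxx /=.
  by rewrite -expr2 sqrr_sign.
have ->: f = \sum_A ext_const (f A) * ext_basis A.
  apply/ffunP=> B; rewrite sum_ffunE.
  rewrite -[LHS](sum_delta f); apply: eq_bigr => A _.
  by rewrite ext_constM ffunE mulrC.
by apply: big_ind => // A _; apply/Pc/Pb.
Qed.

End ExteriorAlgebra.

Section Koszul.
Variables (F : fieldType) (n : nat).

Local Notation S := {mpoly F[n]}.
Definition koszul : pzRingType := ext S n.

Implicit Types (A B C : {set 'I_n}) (f g : koszul) (i j : 'I_n).

Definition koszul_x i : koszul := ext_const n ('X_i : S).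
Definition koszul_u i : koszul := ext_gen S i.

(* The derivation with [d u_i = x_i] and [d x_i = 0]; since removing [j] from
   [j |: C] produces the sign [ext_sign [set j] C], which is zero when [j] is
   in [C], the coefficient of [u_C] in [d f] is as follows. *)
Definition koszul_diff f : koszul :=
  [ffun C => \sum_j ext_sign S [set j] C * ('X_j * (f : ext S n) (j |: C))].

(* [deg x_i = 2] and [deg u_i = 1]. *)
Definition koszul_hom (k : nat) (f : koszul) : Prop :=
  forall A, (f : ext S n) A = 0 \/
    exists2 d, (d.*2 + #|A|)%N = k & (f : ext S n) A \is d.-homog.

Lemma koszul_diff_zmod_morphism : zmod_morphism koszul_diff.
Proof.
move=> f g; apply/ffunP=> C; rewrite !ffunE -sumrB; apply: eq_bigr => j _.
by rewrite !ffunE; ring.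
Qed.
HB.instance Definition _ := GRing.isZmodMorphism.Build koszul koszul
  koszul_diff koszul_diff_zmod_morphism.

Lemma koszul_diff_constM (c : S) f :
  koszul_diff (ext_const n c * f) = ext_const n c * koszul_diff f.
Proof.
apply/ffunP=> C; rewrite ext_constM !ffunE mulr_sumr; apply: eq_bigr => j _.
by rewrite ext_constM; ring.
Qed.

Lemma ext_sign1M i A : i \notin A ->
  ext_sign S [set i] A * ext_sign S [set i] A = 1.
Proof. by move=> iA; rewrite /ext_sign disjoints1 iA -expr2 sqrr_sign. Qed.

Lemma ext_sign1_in i A : i \in A -> ext_sign S [set i] A = 0.
Proof. by move=> iA; rewrite /ext_sign disjoints1 iA. Qed.

Lemma ext_sign11 i j : i != j ->
  ext_sign S [set i] [set j] = - ext_sign S [set j] [set i].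
Proof.
move=> ij; rewrite /ext_sign !disjoints1 !inE [j == i]eq_sym (negPf ij).
rewrite /inversions !big_set1.
by case: ltngtP => [_|_|/val_inj eq_ij]; rewrite ?opprK //; rewrite eq_ij eqxx in ij.
Qed.

Lemma koszul_diff_genM i f :
  koszul_diff (koszul_u i * f) = koszul_x i * f - koszul_u i * koszul_diff f.
Proof.
apply/ffunP=> C; rewrite [RHS]ffunE [X in _ + X]ffunE ext_constM ext_genM !ffunE.
under eq_bigr => j _ do rewrite ext_genM.
have [iC|iC] := boolP (i \in C); last first.
  rewrite subr0 (bigD1 i) //= setU11 setU1K // [X in _ + X]big1 ?addr0.
    by rewrite mulrCA [X in _ * X]mulrA ext_sign1M // mul1r.
  move=> j ij; rewrite in_setU1 (negPf iC) eq_sym (negPf ij) /=.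
  by rewrite !mulr0.
have iC' : i \notin C :\ i by rewrite setD11.
rewrite [LHS](bigD1 i) //= (ext_sign1_in iC) mul0r add0r.
rewrite [in RHS](bigD1 i) //= setD1K // mulrDr mulrA ext_sign1M // mul1r.
rewrite opprD addNKr mulr_sumr -sumrN; apply: eq_bigr => j ji.
rewrite in_setU1 iC orbT.
have [jC|jC] := boolP (j \in C).
  rewrite (ext_sign1_in jC) (@ext_sign1_in j (C :\ i)) ?inE ?ji //.
  by rewrite !mul0r mulr0 oppr0.
have -> : (j |: C) :\ i = j |: (C :\ i).
  by apply/setP=> l; rewrite !inE; case: eqP => [->|] //=; rewrite eq_sym (negPf ji).
rewrite -{1}(setD1K iC) !ext_signUr ?disjoints1 ?setD11 //; last first.
  by rewrite !inE ji.
have /ext_sign1M ss : i \notin [set j] by rewrite inE eq_sym.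
rewrite (ext_sign11 ji).
transitivity (- (ext_sign S [set i] [set j] * ext_sign S [set i] [set j]) *
  (ext_sign S [set i] (C :\ i) * (ext_sign S [set j] (C :\ i) *
  ('X_j * (f : ext S n) (j |: C :\ i))))); first by ring.
by rewrite ss mulN1r.
Qed.

Lemma koszul_diff1 : koszul_diff 1 = 0.
Proof.
apply/ffunP=> C; rewrite !ffunE big1 // => j _; rewrite ffunE.
by rewrite -subset0 subUset sub1set inE /= !mulr0.
Qed.

Lemma koszul_diffK f : koszul_diff (koszul_diff f) = 0.
Proof.
move: f; apply: ext_ind => [||f g df dg|c f df|i f df].
- by rewrite koszul_diff1 raddf0.
- by rewrite !raddf0.
- by rewrite !raddfD /= df dg addr0.
- by rewrite !koszul_diff_constM df mulr0.
- rewrite koszul_diff_genM raddfB /= koszul_diff_constM koszul_diff_genM df.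
  by rewrite mulr0 subr0 subrr.
Qed.

Lemma koszul_hom0 k : koszul_hom k 0.
Proof. by move=> A; left; rewrite ffunE. Qed.

Lemma koszul_homB k f g : koszul_hom k f -> koszul_hom k g -> koszul_hom k (f - g).
Proof.
move=> hf hg A; rewrite !ffunE.
have [-> | [d dk fd]] := hf A; have [-> | [e ek ge]] := hg A.
- by left; rewrite subr0.
- by right; exists e; rewrite // sub0r rpredN.
- by right; exists d; rewrite // subr0.
have de : d = e.
  by move/eqP: ek; rewrite -dk eqn_add2r => /eqP/double_inj.
by right; exists d; rewrite // rpredB // de.
Qed.

Lemma koszul_homN k f : koszul_hom k f -> koszul_hom k (- f).
Proof. by rewrite -[- f]add0r; apply: koszul_homB; exact: koszul_hom0. Qed.

Lemma koszul_homD k f g : koszul_hom k f -> koszul_hom k g -> koszul_hom k (f + g).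
Proof. by move=> hf /koszul_homN hg; rewrite -[g]opprK; exact: koszul_homB. Qed.

Lemma koszul_hom_coeff k f A m : koszul_hom k f ->
  ((f : ext S n) A)@_m != 0 -> ((mdeg m).*2 + #|A|)%N = k.
Proof.
move=> /(_ A)[-> | [d <- /dhomogP hd] fm]; first by rewrite mcoeff0 eqxx.
by rewrite (hd m) // mcoeff_msupp.
Qed.

Lemma koszul_hom_split f : graded_sum koszul_hom f.
Proof.
pose mono A m : koszul :=
  [ffun B => if B == A then ((f : ext S n) A)@_m *: 'X_[m] else 0].
have -> : f = \sum_A \sum_(m <- msupp ((f : ext S n) A)) mono A m.
  apply/ffunP=> B; rewrite sum_ffunE (bigD1 B) //= [X in _ + X]big1 ?addr0.
    rewrite sum_ffunE [LHS]mpolyE; apply: eq_bigr => m _.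
    by rewrite ffunE eqxx.
  move=> A AB; rewrite sum_ffunE big1 // => m _.
  by rewrite ffunE eq_sym (negPf AB).
apply: graded_sum_big => [||A _]; [exact: koszul_hom0|exact: koszul_homD|].
apply: graded_sum_big => [||m _]; [exact: koszul_hom0|exact: koszul_homD|].
apply: (@graded_sum1 _ _ koszul_hom0 ((mdeg m).*2 + #|A|)) => B; rewrite ffunE.
case: eqP => [-> | _]; [right; exists (mdeg m) | left] => //.
by rewrite rpredZ // dhomogX.
Qed.

Lemma koszul_hom_direct k (f : nat -> koszul) :
    (forall l : nat, koszul_hom l (f l)) ->
  \sum_(l < k) f l = 0 -> forall l : nat, (l < k)%N -> f l = 0.
Proof.
move=> hf f0 i ik; apply/ffunP=> A; apply/mpolyP=> m; rewrite ffunE mcoeff0.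
apply/eqP/negPn/negP=> fm.
have /ffunP/(_ A) := f0; rewrite sum_ffunE ffunE => /(congr1 (mcoeff m)).
rewrite raddf_sum mcoeff0 (bigD1 (Ordinal ik)) //= big1 ?addr0.
  by move/eqP; rewrite (negPf fm).
move=> j; rewrite -val_eqE /= => ji; apply/eqP/negPn/negP=> fjm.
have := koszul_hom_coeff (hf j) fjm.
by rewrite (koszul_hom_coeff (hf i) fm) => /eqP; rewrite eq_sym (negPf ji).
Qed.

Lemma koszul_hom1 : koszul_hom 0 1.
Proof.
move=> A; rewrite ffunE; case: eqP => [-> | _]; [right | left] => //.
by exists 0; rewrite ?cards0 // dhomog1.
Qed.

Lemma koszul_hom_sum k (I : finType) (P : pred I) (G : I -> koszul) :
  (forall t : I, P t -> koszul_hom k (G t)) -> koszul_hom k (\sum_(t | P t) G t).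
Proof.
by move=> hG; apply: big_ind => //; [exact: koszul_hom0 | exact: koszul_homD].
Qed.

Lemma koszul_homM k l f g : koszul_hom k f -> koszul_hom l g ->
  koszul_hom (k + l) (f * g).
Proof.
move=> hf hg.
pose h A B : koszul := [ffun C => if A :|: B == C then
  ext_sign S A B * ((f : ext S n) A * (g : ext S n) B) else 0].
have -> : f * g = \sum_A \sum_B h A B.
  apply/ffunP=> C; rewrite ffunE sum_ffunE; apply: eq_bigr => A _.
  by rewrite sum_ffunE big_mkcond; apply: eq_bigr => B _; rewrite ffunE.
apply: koszul_hom_sum => A _; apply: koszul_hom_sum => B _ C; rewrite ffunE.
case: eqP => [<- | _]; last by left.
have [-> | [d <- fd]] := hf A; first by left; rewrite mul0r mulr0.
have [-> | [e <- ge]] := hg B; first by left; rewrite !mulr0.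
rewrite /ext_sign; case: ifPn => [dAB | _]; last by left; rewrite mul0r.
right; exists (d + e)%N.
  by rewrite doubleD cardsU (disjoint_setI0 dAB) cards0 subn0 addnACA.
by rewrite -signr_odd mulr_sign; case: ifP => _; rewrite ?rpredN dhomogM.
Qed.

Lemma koszul_hom_diff k f : koszul_hom k f -> koszul_hom k.+1 (koszul_diff f).
Proof.
move=> hf.
pose h j : koszul := [ffun C => ext_sign S [set j] C * ('X_j * (f : ext S n) (j |: C))].
have -> : koszul_diff f = \sum_j h j.
  by apply/ffunP=> C; rewrite sum_ffunE ffunE; apply: eq_bigr => j _; rewrite ffunE.
apply: koszul_hom_sum => j _ C; rewrite ffunE.
have [jC|jC] := boolP (j \in C); first by left; rewrite ext_sign1_in // mul0r.
have [-> | [d <- fd]] := hf (j |: C); first by left; rewrite !mulr0.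
right; exists d.+1; first by rewrite doubleS cardsU1 jC /= add1n addnS.
rewrite /ext_sign -signr_odd; case: ifP => _; last by rewrite mul0r rpred0.
rewrite mulr_sign; case: ifP => _; rewrite ?rpredN -add1n dhomogM //.
all: by rewrite dhomogX /= mdeg1.
Qed.

Definition koszul_bar f : koszul :=
  [ffun A : {set 'I_n} => (-1) ^+ #|A| * (f : ext S n) A].

Lemma koszul_bar_hom k f : koszul_hom k f -> koszul_bar f = (-1) ^+ k * f.
Proof.
move=> hf; have -> : (-1) ^+ k * f = ext_const n ((-1) ^+ k : S) * f.
  rewrite -[in LHS]signr_odd -[in RHS]signr_odd mulr_sign; apply/ffunP=> A.
  rewrite ext_constM mulr_sign; case: ifP => // _; first by rewrite !ffunE.
apply/ffunP=> A; rewrite ext_constM ffunE.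
have [-> | [d <- _]] := hf A; first by rewrite !mulr0.
by rewrite exprD -muln2 exprM sqrr_sign mul1r.
Qed.

Lemma koszul_bar_diffM f g :
  koszul_diff (f * g) = koszul_diff f * g + koszul_bar f * koszul_diff g.
Proof.
move: f g; apply: ext_ind => [g|g|f1 f2 IH1 IH2 g|c f IH g|i f IH g].
- rewrite mul1r koszul_diff1 mul0r add0r; have -> : koszul_bar 1 = 1; last by rewrite mul1r.
  apply/ffunP=> A; rewrite !ffunE; case: eqP => [-> | _]; last by rewrite mulr0.
  by rewrite cards0 mul1r.
- rewrite mul0r !raddf0 mul0r add0r; have -> : koszul_bar 0 = 0; last by rewrite mul0r.
  by apply/ffunP=> A; rewrite !ffunE mulr0.
- rewrite mulrDl !raddfD /= IH1 IH2 mulrDl.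
  have -> : koszul_bar (f1 + f2) = koszul_bar f1 + koszul_bar f2.
    by apply/ffunP=> A; rewrite !ffunE mulrDr.
  by rewrite mulrDl addrACA.
- rewrite -mulrA !koszul_diff_constM IH mulrDr !mulrA; congr (_ + _ * _).
  by apply/ffunP=> A; rewrite [RHS]ffunE !ext_constM ffunE; ring.
- have -> : koszul_bar (ext_gen S i * f) = - (koszul_u i * koszul_bar f).
    apply/ffunP=> A; rewrite [LHS]ffunE [RHS]ffunE !ext_genM.
    case: ifP => iA; last by rewrite mulr0 oppr0.
    by rewrite ffunE [in LHS](cardsD1 i A) iA exprS; ring.
  rewrite -mulrA !koszul_diff_genM IH mulrBl mulNr -!mulrA mulrDr opprD.
  by rewrite addrA.
Qed.

Lemma koszul_diffM k f g : koszul_hom k f ->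
  koszul_diff (f * g) = koszul_diff f * g + (-1) ^+ k * f * koszul_diff g.
Proof. by move=> hf; rewrite koszul_bar_diffM (koszul_bar_hom hf). Qed.

Definition koszul_dga : dga :=
  Dga koszul_hom0 koszul_homB koszul_hom_split koszul_hom_direct koszul_hom1
    koszul_homM koszul_hom_diff koszul_diffK koszul_diffM.

End Koszul.

Section QuotientDga.
Variables (A : dga) (G : A -> Prop).
Hypothesis G_hom : forall g, G g -> exists i, hom i g.
Hypothesis G_diff : forall g, G g -> in_ideal G (diff A g).

Definition quot_ideal : biideal A := BiIdeal.clone A (ideal_gen G) _.
Local Notation Q := (ring_quot quot_ideal).
Local Notation pi := (quot_pi quot_ideal).

Lemma quot_idealP x : reflect (in_ideal G x) (x \in (quot_ideal : {pred A})).
Proof. exact: ideal_genP. Qed.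

Lemma diff_ideal x : x \in (quot_ideal : {pred A}) ->
  diff A x \in (quot_ideal : {pred A}).
Proof.
move/quot_idealP; elim=> [|a g b y Gg _ IH]; first by rewrite raddf0 rpred0.
rewrite raddfD /=; apply: rpredD => //.
have gJ : g \in (quot_ideal : {pred A}) by exact: ideal_gen_sub.
have dgJ : diff A g \in (quot_ideal : {pred A}) by apply/quot_idealP/G_diff.
have [e hg] := G_hom Gg; have [n [f [hf ->]]] := hom_split a.
rewrite -mulrA mulr_suml raddf_sum; apply: rpred_sum => i _.
rewrite /= (diffM _ (hf i)) (diffM _ hg); apply: rpredD.
  exact/bi_mull/bi_mulr.
by apply/bi_mull/rpredD; [exact: bi_mulr | rewrite -mulrA; exact/bi_mull/bi_mulr].
Qed.

Definition quot_diff (q : Q) : Q := pi (diff A (sval (quot_pi_surj q))).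

Lemma quot_diffE x : quot_diff (pi x) = pi (diff A x).
Proof.
rewrite /quot_diff; case: quot_pi_surj => x' /= /quot_piP xx'; apply/quot_piP.
by rewrite -raddfB; exact: diff_ideal.
Qed.

Lemma quot_diff_zmod_morphism : zmod_morphism quot_diff.
Proof.
move=> p q; case: (quot_pi_surj p) (quot_pi_surj q) => x <- [y <-].
by rewrite -raddfB !quot_diffE !raddfB.
Qed.
HB.instance Definition _ := GRing.isZmodMorphism.Build Q Q quot_diff
  quot_diff_zmod_morphism.

Definition quot_hom (i : nat) (q : Q) : Prop := exists2 x : A, hom i x & q = pi x.

Lemma ideal_hom_split x : x \in (quot_ideal : {pred A}) ->
  graded_sum (fun i y => hom i y /\ y \in (quot_ideal : {pred A})) x.
Proof.
set homJ := fun i y => _.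
have homJ0 i : homJ i 0 by split; [exact: hom0 | exact: rpred0].
have homJD i y z : homJ i y -> homJ i z -> homJ i (y + z).
  by move=> [hy yJ] [hz zJ]; split; [exact: homD | exact: rpredD].
move/quot_idealP; elim=> [|a g b y Gg _ IH]; first exact: graded_sum0.
apply: graded_sumD => //; have [e hg] := G_hom Gg.
have [n [f [hf ->]]] := hom_split a; have [m [h [hh ->]]] := hom_split b.
rewrite !mulr_suml; apply: graded_sum_big => // i _.
rewrite mulr_sumr; apply: graded_sum_big => // j _.
apply: (@graded_sum1 _ _ homJ0 (i + e + j)); split; first exact/homM/hh/homM.
by apply/bi_mulr/bi_mull/ideal_gen_sub.
Qed.

Lemma quot_hom0 i : quot_hom i 0.
Proof. by exists 0; [exact: hom0 | rewrite raddf0]. Qed.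

Lemma quot_homB i p q : quot_hom i p -> quot_hom i q -> quot_hom i (p - q).
Proof.
by move=> [x hx ->] [y hy ->]; exists (x - y); [exact: homB | rewrite raddfB].
Qed.

Lemma quot_hom_split q : graded_sum quot_hom q.
Proof.
case: (quot_pi_surj q) => x <-; have [n [f [hf ->]]] := hom_split x.
by exists n, (fun i => pi (f i)); split=> [i|]; [exists (f i) | rewrite raddf_sum].
Qed.

Lemma quot_hom_direct n (f : nat -> Q) : (forall i, quot_hom i (f i)) ->
  \sum_(i < n) f i = 0 -> forall i, (i < n)%N -> f i = 0.
Proof.
move=> hf f0 i lt_in.
have /choice[x hx] : forall j, exists x, hom j x /\ f j = pi x.
  by move=> j; have [x] := hf j; exists x.
have /ideal_hom_split[m [y [hy xy]]] : \sum_(j < n) x j \in (quot_ideal : {pred A}).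
  rewrite -[\sum_(_ < _) _]subr0; apply/quot_piP; rewrite raddf0 -f0 raddf_sum.
  by apply: eq_bigr => j _; rewrite (hx j).2.
pose x' j := if (j < n)%N then x j else 0; pose y' j := if (j < m)%N then y j else 0.
have lt_i : (i < maxn n m)%N by rewrite leq_max lt_in.
have := @hom_eq A (maxn n m) x' y' _ _ _ i lt_i.
rewrite /x' /y' lt_in => xyE; rewrite (hx i).2 xyE.
- by rewrite -(raddf0 pi); apply/quot_piP; rewrite subr0; case: ifP => _;
    [exact: (hy i).2 | exact: rpred0].
- by move=> j; case: ifP => _; [exact: (hx j).1 | exact: hom0].
- by move=> j; case: ifP => _; [exact: (hy j).1 | exact: hom0].
- by rewrite -(graded_sumW x (leq_maxl n m)) -(graded_sumW y (leq_maxr n m)).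
Qed.

Lemma quot_hom1 : quot_hom 0 1.
Proof. by exists 1; [exact: hom1 | rewrite rmorph1]. Qed.

Lemma quot_homM i j p q : quot_hom i p -> quot_hom j q -> quot_hom (i + j) (p * q).
Proof.
by move=> [x hx ->] [y hy ->]; exists (x * y); [exact: homM | rewrite rmorphM].
Qed.

Lemma quot_hom_diff i p : quot_hom i p -> quot_hom i.+1 (quot_diff p).
Proof.
move=> [x hx ->]; exists (diff A x); first exact: hom_diff.
exact: quot_diffE.
Qed.

Lemma quot_diffK p : quot_diff (quot_diff p) = 0.
Proof.
by case: (quot_pi_surj p) => x <-; rewrite !quot_diffE diffK raddf0.
Qed.

Lemma quot_diffM i p q : quot_hom i p ->
  quot_diff (p * q) = quot_diff p * q + (-1) ^+ i * p * quot_diff q.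
Proof.
case: (quot_pi_surj q) => y <- [x hx ->].
rewrite -rmorphM !quot_diffE (diffM _ hx) rmorphD !rmorphM.
by rewrite rmorphXn rmorphN1.
Qed.

Definition quot_dga : dga :=
  Dga quot_hom0 quot_homB quot_hom_split quot_hom_direct quot_hom1 quot_homM
    quot_hom_diff quot_diffK quot_diffM.

End QuotientDga.

Section Cochains.
Variables (F : fieldType) (n : nat) (K : {set {set 'I_n}}).

Definition face_monomial (s : {set 'I_n}) : {mpoly F[n]} := \prod_(i in s) 'X_i.

(* The quotient by [I_K] and then by [x_i ^ 2], [x_i u_i] is taken in one step. *)
Inductive cw_relation : koszul F n -> Prop :=
| cw_nonface s : s \notin K -> cw_relation (ext_const n (face_monomial s))
| cw_square i : cw_relation (koszul_x F i ^+ 2)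
| cw_xu i : cw_relation (koszul_x F i * koszul_u F i).

Lemma ext_const_hom d (c : {mpoly F[n]}) : c \is d.-homog ->
  @koszul_hom F n d.*2 (ext_const n c).
Proof.
move=> cd A; rewrite ffunE; case: eqP => [->|_]; [right | by left].
by exists d; rewrite ?cards0 ?addn0.
Qed.

Lemma koszul_x_hom i : @koszul_hom F n 2 (koszul_x F i).
Proof. by apply: (@ext_const_hom 1); rewrite dhomogX /= mdeg1. Qed.

Lemma koszul_u_hom i : @koszul_hom F n 1 (koszul_u F i).
Proof.
move=> A; rewrite ffunE; case: eqP => [->|_]; [right | by left].
by exists 0; rewrite ?cards1 // dhomog1.
Qed.

Lemma cw_relation_hom (g : koszul_dga F n) : cw_relation g -> exists k, hom k g.
Proof.
case=> [s _|i|i].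
- exists (#|s|.*2); apply: (@ext_const_hom #|s|); rewrite /face_monomial -sum1_card.
  apply: (big_rec2 (fun p d => p \is d.-homog)) => [|i p d _ pd]; first exact: dhomog1.
  by apply: dhomogM => //; rewrite dhomogX /= mdeg1.
- by exists (2 + 2)%N; rewrite expr2; apply: koszul_homM; exact: koszul_x_hom.
- by exists (2 + 1)%N; apply: koszul_homM; [exact: koszul_x_hom | exact: koszul_u_hom].
Qed.

Lemma koszul_diff_const (c : {mpoly F[n]}) :
  @koszul_diff F n (ext_const n c) = 0.
Proof.
rewrite -[ext_const n c]mulr1 -[1 : ext _ _]/(1 : koszul F n).
by rewrite koszul_diff_constM koszul_diff1 mulr0.
Qed.

Lemma cw_relation_diff (g : koszul_dga F n) :
  cw_relation g -> in_ideal cw_relation (diff (koszul_dga F n) g).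
Proof.
case=> [s _|i|i] /=.
- rewrite koszul_diff_const; exact: in_ideal0.
- rewrite expr2 koszul_diff_constM koszul_diff_const mulr0; exact: in_ideal0.
- rewrite koszul_diff_constM -[koszul_u F i]mulr1 koszul_diff_genM koszul_diff1.
  rewrite mulr0 subr0 mulr1 -expr2.
  exact/ideal_genP/ideal_gen_sub/cw_square.
Qed.

(* The cellular cochain algebra of the moment-angle complex [Z_K]: its cohomology
   is [H^*(Z_K, F)], in which Massey products are computed from it. *)
Definition cw_cochains : dga := quot_dga cw_relation_hom cw_relation_diff.

End Cochains.

Definition alexander_dual n (K : {set {set 'I_n}}) : {set {set 'I_n}} :=
  [set ~: s | s : {set 'I_n} & s \notin K].

(* The two copies of the vertex set are the two halves of ['I_(n + n)]. *)
Definition bier n (K : {set {set 'I_n}}) : {set {set 'I_(n + n)}} :=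
  [set (@lshift n n @: s) :|: (@rshift n n @: t) |
     s : {set 'I_n} in K, t : {set 'I_n} in alexander_dual K
     & [disjoint s & t]].

Definition vertices n (K : {set {set 'I_n}}) : {set 'I_n} :=
  [set i | [set i] \in K].

(* For a squarefree monomial ideal [I], the complex with [I_K = I]. *)
Definition complex_of_ideal (F : fieldType) n (I : {pred {mpoly F[n]}}) :
    {set {set 'I_n}} :=
  [set s | face_monomial F s \notin I].

(* [x i] is the variable [x_i] for [1 <= i <= 8]; the vertex [i] of [{1,...,8}] is
   the element [i.-1] of ['I_8]. *)
Definition K8_generators (F : fieldType) : seq {mpoly F[8]} :=
  let x (i : nat) : {mpoly F[8]} := 'X_(inord i.-1) in
  [:: x 1 * x 2; x 1 * x 3 * x 4 * x 5; x 3 * x 4 * x 5 * x 6;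
      x 3 * x 5 * x 6 * x 7; x 7 * x 8].

Definition K8 (F : fieldType) : {set {set 'I_8}} :=
  complex_of_ideal (ideal_gen (fun g => g \in K8_generators F)).

(* Main.v *)
From HB Require Import structures.
Require Import Defs.
From mathcomp Require Import all_boot all_order all_algebra.
From mathcomp Require Import mpoly.
From mathcomp Require Import boolp ring.

Import GRing.Theory.
Local Open Scope ring_scope.

(** Write [x_i], [u_i] for the generators attached to the first copy of the
    vertex set, on which the Bier sphere restricts to [K]. The product is
    [<[x_1 u_2], [x_3 x_4 x_5 u_6], [x_7 u_8]>], of total degree 3 + 7 + 3 - 1.
    The first two representatives multiply to zero, because of the relation
    [x_1 x_3 x_4 x_5], and the last two multiply to the coboundary of
    [y = x_3 x_5 x_7 u_4 u_6 u_8], because of [x_3 x_5 x_6 x_7] and [x_7 x_8]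
    (lemma [diff_primitive]). So the product contains the class of
    [x_1 u_2 y], up to sign the monomial [x_1 x_3 x_5 x_7 u_2 u_4 u_6 u_8].

    To prove that it is indecomposable, we give a linear functional [detector]
    on cochains that vanishes on coboundaries and on every product of two
    cocycles of positive degree, and is nonzero on this monomial. Two elements
    of a Massey product differ by products of classes of positive degree, so
    such a functional is constant on the whole Massey product, with a nonzero
    value, while it is zero on decomposable classes
    ([massey_indecomposable], which holds in any dga).

    Geometrically, let [L] be the 4-sphere obtained as the join of the two
    points 1, 2, the boundary of the simplex 3456 and the two points 7, 8. Then
    [K] is [L] minus the open stars of the simplices 1345 and 3567, and the
    functional is evaluation on the boundary of the star of 1345, a 3-cycle
    that generates the reduced homology of [K] in dimension 3. Evaluation on a
    simplex [s] is, up to sign, the coefficient of [x_s u_c] with [c] the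
    complement of [s] in {1,...,8}; it is written as the constant term after
    applying the derivations [d/dx_i], [i] in [s], and [d/du_i], [i] in [c].
    These satisfy [[d/dx_i, d] = d/du_i], which is Stokes' theorem here
    ([ev_cons_diff]).

    In this form [detector f] is [chain (d f)], where [chain] evaluates on the
    two 4-simplices 13457 and 13458 of the star, which are not in [K]. It
    vanishes on coboundaries since [d d = 0], and on the ideal of relations
    because the common face 1345 of the two simplices cancels and the other
    3-faces are in [K]. For two cocycles [f], [g] of positive degree modulo the
    ideal, [d (f g) = d f g +- f d g], where [r = d f] and [d g] are in the
    ideal; the two terms are alike. By the Leibniz rule [chain (r g)] is a sum
    over the ways to distribute the derivations between [r] and [g] ([ev_mul]).
    A term vanishes unless all of 1345 falls on [r], and then a cone argument
    kills either the factor of [r] or that of [g] ([split_ev_eq0]): in each case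
    one of the two full subcomplexes has no cohomology in the degree that
    matters. *)

Set Implicit Arguments.
Unset Strict Implicit.
Unset Printing Implicit Defensive.

Local Notation hom := Defs.hom.

(** * Contractions of the Koszul algebra *)

Section Contractions.
Context {F : fieldType} {n : nat}.
Local Notation S := {mpoly F[n]}.
Implicit Types (f g : koszul F n) (i j : 'I_n) (s c : seq 'I_n).

(** The even derivation [d/dx_i]. *)
Definition ddx i f : koszul F n := [ffun A : {set 'I_n} => ((f : ext S n) A)^`M(i)].

(** The odd derivation [d/du_i]: [ext_sign] is zero when [i] is in [A], and
    otherwise it is the sign of moving [u_i] to the front of [u_(i |: A)]. *)
Definition ddu i f : koszul F n :=
  [ffun A : {set 'I_n} => ext_sign S [set i] A * (f : ext S n) (i |: A)].
Definition augmentation f : F := ((f : ext S n) set0)@_0.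

Lemma ddx_is_zmod_morphism i : zmod_morphism (ddx i).
Proof. by move=> f g; apply/ffunP=> A; rewrite !ffunE mderivB. Qed.
HB.instance Definition _ i := GRing.isZmodMorphism.Build _ _ (ddx i)
  (ddx_is_zmod_morphism i).

Lemma ddu_is_zmod_morphism i : zmod_morphism (ddu i).
Proof. by move=> f g; apply/ffunP=> A; rewrite !ffunE mulrBr. Qed.
HB.instance Definition _ i := GRing.isZmodMorphism.Build _ _ (ddu i)
  (ddu_is_zmod_morphism i).

Lemma augmentation_is_zmod_morphism : zmod_morphism augmentation.
Proof. by move=> f g; rewrite /augmentation !ffunE mcoeffB. Qed.
HB.instance Definition _ := GRing.isZmodMorphism.Build _ _ augmentation
  augmentation_is_zmod_morphism.

Lemma ext_sign_mderiv i (A B : {set 'I_n}) (p : S) :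
  (ext_sign S A B * p)^`M(i) = ext_sign S A B * p^`M(i).
Proof.
rewrite /ext_sign; case: ifP => _; last by rewrite !mul0r mderiv0.
by rewrite -signr_odd !mulr_sign; case: ifP; rewrite ?mderivN.
Qed.

Lemma ddxM i f g : ddx i (f * g) = ddx i f * g + f * ddx i g.
Proof.
apply/ffunP=> C; rewrite !ffunE raddf_sum -big_split /=; apply: eq_bigr => A _.
rewrite raddf_sum -big_split /=; apply: eq_bigr => B _.
by rewrite ext_sign_mderiv mderivM !ffunE mulrDr.
Qed.

Lemma ddx_bar i f : ddx i (koszul_bar f) = koszul_bar (ddx i f).
Proof.
apply/ffunP=> A; rewrite !ffunE -signr_odd !mulr_sign.
by case: ifP; rewrite ?mderivN.
Qed.

Lemma diff_bar f : koszul_diff (koszul_bar f) = - koszul_bar (koszul_diff f).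
Proof.
apply/ffunP=> C; rewrite !ffunE mulr_sumr -sumrN; apply: eq_bigr => j _.
rewrite ffunE; have [jC|jC] := boolP (j \in C).
  by rewrite ext_sign1_in // !mul0r mulr0 oppr0.
by rewrite cardsU1 jC exprS; ring.
Qed.

Lemma ddx_dduC i j f : ddx i (ddu j f) = ddu j (ddx i f).
Proof. by apply/ffunP=> A; rewrite !ffunE ext_sign_mderiv. Qed.

(** The differential is the sum of the operators [x_j d/du_j], so that only
    the coefficient [x_i] contributes to the commutator. The anticommutation and
    product rules for [ddu] below follow from this one. *)
Lemma ddx_diff i f : ddx i (koszul_diff f) = ddu i f + koszul_diff (ddx i f).
Proof.
apply/ffunP=> C; rewrite !ffunE raddf_sum /=.
under eq_bigr => j _ do rewrite ext_sign_mderiv mderivM mulrDr.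
rewrite big_split /=; congr (_ + _); last by apply: eq_bigr => j _; rewrite ffunE.
rewrite (bigD1 i) //= big1 ?addr0 => [|j ji].
  rewrite mderivX mnm1E eqxx scale1r.
  have -> : (U_(i) - U_(i))%MM = 0%MM :> 'X_{1..n}.
    by apply/mnmP=> k; rewrite mnmBE subnn mnm0E.
  by rewrite mpolyX0 mul1r.
by rewrite mderivX mnm1E (negPf ji) scale0r mul0r mulr0.
Qed.

Lemma dduE i f : ddu i f = ddx i (koszul_diff f) - koszul_diff (ddx i f).
Proof. by rewrite ddx_diff addrK. Qed.

Lemma diff_ddu i f : koszul_diff (ddu i f) = - ddu i (koszul_diff f).
Proof. by rewrite !dduE koszul_diffK raddf0 raddfB /= koszul_diffK subr0 sub0r opprK. Qed.

Lemma ddu_dduC i j f : ddu i (ddu j f) = - ddu j (ddu i f).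
Proof.
rewrite [LHS]dduE diff_ddu raddfN /= !ddx_dduC diff_ddu opprK.
by rewrite (dduE i) raddfB /= opprB addrC.
Qed.

Lemma bar_is_zmod_morphism : zmod_morphism (@koszul_bar F n).
Proof. by move=> f g; apply/ffunP=> A; rewrite !ffunE mulrBr. Qed.
HB.instance Definition _ := GRing.isZmodMorphism.Build _ _ (@koszul_bar F n)
  bar_is_zmod_morphism.

Lemma ddu_bar i f : ddu i (koszul_bar f) = - koszul_bar (ddu i f).
Proof. by rewrite !dduE diff_bar ddx_bar diff_bar raddfN /= ddx_bar raddfB opprD. Qed.

Lemma dduM i f g : ddu i (f * g) = ddu i f * g + koszul_bar f * ddu i g.
Proof.
rewrite !dduE ddxM koszul_bar_diffM !raddfD /= !ddxM !koszul_bar_diffM ddx_bar.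
rewrite mulrBl mulrBr -opprD.
have cancel (V : zmodType) (p q r t p' t' : V) :
    p + q + (r + t) - (p' + r + (q + t')) = p - p' + (t - t').
  rewrite [p + q + _]addrACA opprD [LHS]addrACA.
  by congr (_ + _); rewrite opprD addrACA subrr ?addr0 ?add0r.
exact: cancel.
Qed.

Lemma augmentationM f g :
  augmentation (f * g) = augmentation f * augmentation g.
Proof.
rewrite /augmentation -rmorphM ffunE (bigD1 set0) //= [X in _ + X]big1 ?addr0.
  rewrite (bigD1 set0) ?setU0 //= [X in _ + X]big1 ?addr0.
    by rewrite ext_sign0l mul1r.
  by move=> B /andP[]; rewrite set0U => /eqP->; rewrite eqxx.
by move=> A A0; rewrite big1 // => B; rewrite setU_eq0 (negPf A0).
Qed.

Lemma augmentation_bar f : augmentation (koszul_bar f) = augmentation f.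
Proof. by rewrite /augmentation ffunE cards0 mul1r. Qed.

Lemma augmentation_diff f : augmentation (koszul_diff f) = 0.
Proof.
rewrite /augmentation ffunE raddf_sum big1 // => j _.
by rewrite /= ext_sign0r mul1r rmorphM /= mcoeffX mnm1_eq0 mul0r.
Qed.

Lemma ddx1 i : ddx i 1 = 0.
Proof.
by apply/ffunP=> A; rewrite !ffunE; case: eqP; rewrite ?mderiv0 // -mpolyC1 mderivC.
Qed.

Lemma ddu1 i : ddu i 1 = 0.
Proof.
apply/ffunP=> A; rewrite !ffunE -subset0 subUset sub1set inE /=.
by rewrite mulr0.
Qed.

Lemma ddx_xM i j f :
  ddx i (koszul_x F j * f) = (if i == j then f else 0) + koszul_x F j * ddx i f.
Proof.
apply/ffunP=> A; rewrite [LHS]ffunE [RHS]ffunE !ext_constM mderivM.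
rewrite [in X in _ = _ + X]ffunE.
congr (_ + _); rewrite mderivX mnm1E; case: (eqVneq i j) => [<-|].
  have -> : (U_(i) - U_(i))%MM = 0%MM :> 'X_{1..n}.
    by apply/mnmP=> k; rewrite mnmBE subnn mnm0E.
  by rewrite mpolyX0 scale1r mul1r.
by rewrite scale0r mul0r ffunE.
Qed.

Lemma ddu_xM i j f : ddu i (koszul_x F j * f) = koszul_x F j * ddu i f.
Proof. by apply/ffunP=> A; rewrite [LHS]ffunE !ext_constM [in RHS]ffunE mulrCA. Qed.

Lemma ddx_uM i j f : ddx i (koszul_u F j * f) = koszul_u F j * ddx i f.
Proof.
apply/ffunP=> A; rewrite ffunE !ext_genM; case: ifP => _; last by rewrite mderiv0.
by rewrite ext_sign_mderiv ffunE.
Qed.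

Lemma ddu_uM i j f :
  ddu i (koszul_u F j * f) = (if i == j then f else 0) - koszul_u F j * ddu i f.
Proof.
have cancel (V : zmodType) (e p q r : V) : e + p - q - (p - r) = e - (q - r).
  by rewrite !opprB -[e + p - q]addrA -addrA [p - q + _]addrC [r - p + _]addrA subrK.
rewrite dduE koszul_diff_genM (raddfB (ddx i)) /= ddx_xM !ddx_uM koszul_diff_genM.
by rewrite (dduE i f) mulrBr; exact: cancel.
Qed.

Lemma ext_constE (a : S) A : ext_const n a A = if A == set0 then a else 0.
Proof. by rewrite ffunE. Qed.

Lemma ext_genE i A : ext_gen S i A = (A == [set i])%:R.
Proof. by rewrite ffunE. Qed.

Lemma koszul_xC i f : f * koszul_x F i = koszul_x F i * f.
Proof.
move: f; apply: ext_ind => [||f g IHf IHg|a f IHf|j f IHf].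
- by rewrite mul1r mulr1.
- by rewrite mul0r mulr0.
- by rewrite mulrDl mulrDr IHf IHg.
- have ax : (ext_const n a : koszul F n) * koszul_x F i = koszul_x F i * ext_const n a.
    apply/ffunP=> A.
    transitivity (a * ext_const n ('X_i : S) A); first exact: ext_constM.
    transitivity ('X_i * ext_const n a A); last exact/esym/ext_constM.
    by rewrite [in LHS]ext_constE [in RHS]ext_constE; case: eqP; rewrite ?mulr0 // mulrC.
  exact: esym (commrM (esym ax) (esym IHf)).
- have ux : koszul_u F j * koszul_x F i = koszul_x F i * koszul_u F j.
    apply/ffunP=> A; transitivity ('X_i * ext_gen S j A); last exact/esym/ext_constM.
    transitivity (if j \in A then ext_sign S [set j] (A :\ j) *
      ext_const n ('X_i : S) (A :\ j) else 0); first exact: ext_genM.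
    rewrite ext_constE ext_genE; case: ifP => jA.
      have -> : (A :\ j == set0) = (A == [set j]).
        by apply/eqP/eqP=> [A0|->]; [rewrite -(setD1K jA) A0 setU0 | rewrite setDv].
      case: eqP => [->|]; last by rewrite !mulr0.
      by rewrite setDv ext_sign0r mulrC.
    by case: eqP => [A1|]; rewrite ?mulr0 //; rewrite A1 inE eqxx in jA.
  exact: esym (commrM (esym ux) (esym IHf)).
Qed.

Lemma augmentation1 : augmentation 1 = 1.
Proof. by rewrite /augmentation ffunE eqxx mcoeff1 eqxx. Qed.

Lemma augmentation_xM i f : augmentation (koszul_x F i * f) = 0.
Proof. by rewrite /augmentation ext_constM rmorphM /= mcoeffX mnm1_eq0 mul0r. Qed.

Lemma augmentation_uM i f : augmentation (koszul_u F i * f) = 0.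
Proof. by rewrite /augmentation ext_genM inE mcoeff0. Qed.

(** Up to sign, the coefficient of [x_s u_c] in [f], when [s] and [c] have no
    repeated and no common element; the first letters of [s] and [c] act
    first. *)
Definition ev s c f : F :=
  augmentation (foldl (fun g i => ddu i g) (foldl (fun g i => ddx i g) f s) c).

Lemma ev_is_zmod_morphism s c : zmod_morphism (ev s c).
Proof.
rewrite /ev; elim: s => [|i s IHs] f g /=; last by rewrite raddfB IHs.
elim: c f g => [|i c IHc] f g /=; first exact: raddfB.
by rewrite raddfB IHc.
Qed.
HB.instance Definition _ s c := GRing.isZmodMorphism.Build _ _ (ev s c)
  (ev_is_zmod_morphism s c).

Lemma ev_cons_ddx i s c f : ev (i :: s) c f = ev s c (ddx i f).
Proof. by []. Qed.

Lemma ev_cons_ddu s i c f : ev s (i :: c) f = ev s c (ddu i f).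
Proof.
rewrite /ev /=; congr (augmentation (foldl _ _ _)).
by elim: s f => //= j s IHs f; rewrite IHs ddx_dduC.
Qed.

Lemma ev_swap s i j c f : ev s (i :: j :: c) f = - ev s (j :: i :: c) f.
Proof. by rewrite !ev_cons_ddu ddu_dduC raddfN. Qed.

Lemma ev_bar s c f : ev s c (koszul_bar f) = (-1) ^+ size c * ev s c f.
Proof.
elim: s f => [|i s IHs] f; last by rewrite !ev_cons_ddx ddx_bar IHs.
elim: c f => [|i c IHc] f; first by rewrite /ev /= augmentation_bar mul1r.
by rewrite !ev_cons_ddu ddu_bar raddfN /= IHc exprS -mulrA mulN1r.
Qed.

Lemma ev_nil_diff c f : ev [::] c (koszul_diff f) = 0.
Proof.
elim: c f => [|i c IHc] f; first exact: augmentation_diff.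
by rewrite ev_cons_ddu -[ddu i _]opprK -diff_ddu raddfN /= IHc oppr0.
Qed.

(** Stokes' theorem: iterated along [s], this writes the value at [s] of a
    coboundary as a sum of values at the simplices [s] minus a vertex [i],
    with no sign, as the vertex [i] becomes the first letter of [c]. *)
Lemma ev_cons_diff i s c f :
  ev (i :: s) c (koszul_diff f) = ev s (i :: c) f + ev s c (koszul_diff (ddx i f)).
Proof. by rewrite ev_cons_ddx ddx_diff raddfD /= ev_cons_ddu. Qed.

Lemma ev_1 s c : ev s c 1 = ((s == [::]) && (c == [::]))%:R.
Proof.
case: s => [|i s] /=; last by rewrite ev_cons_ddx ddx1 raddf0.
case: c => [|i c] /=; last by rewrite ev_cons_ddu ddu1 raddf0.
exact: augmentation1.
Qed.

Lemma ev_xM s c i f : uniq s ->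
  ev s c (koszul_x F i * f) = if i \in s then ev (rem i s) c f else 0.
Proof.
elim: s f => [|j s IHs] f /=.
  move=> _; elim: c f => [|j c IHc] f; first exact: augmentation_xM.
  by rewrite ev_cons_ddu ddu_xM IHc.
move=> /andP[js us]; rewrite ev_cons_ddx ddx_xM raddfD /= IHs // in_cons eq_sym.
case: eqP => [->|_] /=; first by rewrite (negPf js) addr0.
by rewrite raddf0 add0r; case: ifP.
Qed.

Lemma ev_uM0 s c i f : i \notin c -> ev s c (koszul_u F i * f) = 0.
Proof.
elim: s f => [|j s IHs] f; last by rewrite ev_cons_ddx ddx_uM; exact: IHs.
elim: c f => [|j c IHc] f; first by rewrite /ev /= augmentation_uM.
rewrite in_cons negb_or => /andP[ij ic].
by rewrite ev_cons_ddu ddu_uM eq_sym (negPf ij) sub0r raddfN /= IHc // oppr0.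
Qed.

Lemma ev_uM i c1 c2 f : i \notin c1 ++ c2 ->
  ev [::] (c1 ++ i :: c2) (koszul_u F i * f) = (-1) ^+ size c1 * ev [::] (c1 ++ c2) f.
Proof.
elim: c1 f => [|j c1 IHc] f /= ic.
  by rewrite ev_cons_ddu ddu_uM eqxx raddfB /= ev_uM0 // subr0 mul1r.
move: ic; rewrite in_cons negb_or eq_sym => /andP[/negPf ij ic].
by rewrite !ev_cons_ddu ddu_uM ij sub0r raddfN /= IHc // exprS mulN1r mulNr.
Qed.

Fixpoint masks k : seq bitseq :=
  if k is l.+1 then map (cons true) (masks l) ++ map (cons false) (masks l)
  else [:: [::]].

(** The sign created by the letters of [c] that act on the right factor of a
    product: each of them passes the odd derivations that act after it on the
    left factor. *)
Fixpoint mask_sign (b : bitseq) : F :=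
  if b is t :: b' then (if t then 1 else (-1) ^+ count id b') * mask_sign b' else 1.

Lemma size_masks k b : b \in masks k -> size b = k.
Proof.
by elim: k b => [|k IHk] b /=; [rewrite inE => /eqP-> | rewrite mem_cat =>
  /orP[]/mapP[b' /IHk <- ->]].
Qed.

(** The Leibniz rule: each letter of [s] and [c] acts on one of the factors.
    The sign depends on the distribution of [c] only, and not on [f], since the
    parity of [f] is invisible to the constant term. *)
Lemma ev_mul s c f g :
  ev s c (f * g) = \sum_(a <- masks (size s)) \sum_(b <- masks (size c))
    mask_sign b * (ev (mask a s) (mask b c) f *
                   ev (mask (map negb a) s) (mask (map negb b) c) g).
Proof.
elim: s f g => [|i s IHs] f g /=.
  rewrite big_seq1; elim: c f g => [|i c IHc] f g /=.
    by rewrite big_seq1 mul1r; exact: augmentationM.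
  rewrite ev_cons_ddu dduM raddfD /= !IHc big_cat !big_map /=; congr (_ + _).
    by apply: eq_bigr => b _; rewrite mul1r ev_cons_ddu.
  apply: eq_big_seq => b /size_masks bc; rewrite ev_bar size_mask // ev_cons_ddu.
  by rewrite -!mulrA mulrCA.
rewrite ev_cons_ddx ddxM raddfD /= !IHs big_cat !big_map /=; congr (_ + _).
Qed.
End Contractions.

(** * Coefficients at faces *)

Section FaceWords.
Context {F : fieldType} {n : nat} (K : {set {set 'I_n}}).
Implicit Types (f g : koszul F n) (i j : 'I_n) (s c e : seq 'I_n).

Lemma ext_const_prod e :
  ext_const n (\prod_(i <- e) 'X_i) = \prod_(i <- e) koszul_x F i :> koszul F n.
Proof.
apply: (big_morph (fun p => ext_const n p : koszul F n)) => [p q|].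
  by apply/ffunP=> A; rewrite ext_constM !ffunE; case: eqP; rewrite ?mulr0.
by rewrite -ext_one_const.
Qed.

Lemma face_monomial_seq e : uniq e ->
  face_monomial F [set i in e] = \prod_(i <- e) 'X_i.
Proof.
move=> ue; rewrite /face_monomial big_uniq //; apply: eq_bigl => i.
by rewrite inE.
Qed.

Lemma ev_prod_x s c e : uniq s ->
  ev s c (\prod_(i <- e) koszul_x F i) != 0 -> perm_eq s e.
Proof.
elim: e s => [|i e IHe] s us.
  by rewrite big_nil ev_1; case: s {us} => //= ? ?; rewrite eqxx.
rewrite big_cons ev_xM //; case: ifP; last by rewrite eqxx.
by move=> /perm_to_rem si /(IHe _ (rem_uniq _ us)) re; rewrite (permPl si) perm_cons.
Qed.

(** Words for which [ev s c] factors through the quotient by the relations of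
    [K]. The condition bears on all subsets [t] of [s], since each [t] that is
    not in [K] gives a relation that divides [x_s]. *)
Definition face_word s c : Prop :=
  [/\ uniq s, {in c, forall i, i \notin s}
    & forall t : {set 'I_n}, t \subset s -> t \in K].

Lemma face_word_mask a b s c : face_word s c -> face_word (mask a s) (mask b c).
Proof.
move=> [us sc sK]; split=> [|i /mem_mask /sc|t ts]; first exact: mask_uniq.
  by apply: contra => /mem_mask.
by apply: sK; apply: subset_trans ts _; apply/subsetP=> i /mem_mask.
Qed.

Lemma ev_relation s c g : face_word s c -> cw_relation K g -> ev s c g = 0.
Proof.
move=> [us sc sK]; case=> [t tK|i|i].
- apply/eqP; apply: contraNT tK; rewrite /face_monomial -big_enum ext_const_prod.
  move=> /(ev_prod_x us).
  by move=> /perm_mem st; apply: sK; apply/subsetP=> i; rewrite st mem_enum.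
- rewrite expr2 -[X in _ * X]mulr1 !ev_xM ?rem_uniq //; case: ifP => // _.
  by rewrite ?rem_uniq // mem_rem_uniq // !inE eqxx.
- rewrite ev_xM //; case: ifPn => // si; rewrite -[koszul_u F i]mulr1 ev_uM0 //.
  by apply: contraL si => /sc.
Qed.

(** By the Leibniz rule it suffices to evaluate subwords of [s] and [c] at the
    generators; a value that is not zero there means that the generator is the
    monomial [x_t] of a subset [t] of [s], which is a simplex. *)
Lemma ev_ideal s c f : face_word s c -> in_ideal (cw_relation K) f -> ev s c f = 0.
Proof.
move=> fw; elim=> [|a g b x Gg _ IHx]; first exact: raddf0.
rewrite raddfD /= {}IHx addr0 ev_mul big1 // => m _; rewrite big1 // => k _.
suff -> : ev (mask m s) (mask k c) (a * g) = 0 by rewrite mul0r mulr0.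
rewrite ev_mul big1 // => m' _; rewrite big1 // => k' _.
by rewrite [X in _ * X]mulrC (ev_relation _ Gg) ?mul0r ?mulr0 //; do 2!apply: face_word_mask.
Qed.

End FaceWords.

(** * The faces of the complex and of its Bier sphere *)

Lemma ltn_mod8 k : (k %% 8 < 8)%N. Proof. exact: ltn_pmod. Qed.

(** The vertices are labelled from 1 to 8, as in the generators of the ideal.
    Reduction modulo 8 makes this a function that computes, which [inord] is
    not, so that all conditions on explicit simplices hold by computation. *)
Definition vtx (k : nat) : 'I_8 := Ordinal (ltn_mod8 k.-1).

Definition minimal_nonfaces : seq (seq 'I_8) :=
  map (map vtx) [:: [:: 1; 2]; [:: 1; 3; 4; 5]; [:: 3; 4; 5; 6]; [:: 3; 5; 6; 7];
    [:: 7; 8]]%N.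

Definition is_face (s : {pred 'I_8}) : bool :=
  all (fun e => ~~ all (mem s) e) minimal_nonfaces.

Lemma is_faceS (s t : {pred 'I_8}) : {subset t <= s} -> is_face s -> is_face t.
Proof.
move=> ts; apply: sub_all => e; apply: contra; apply: sub_all => i; exact: ts.
Qed.

Section Complex.
Variable F : fieldType.

Lemma K8_generatorsE :
  K8_generators F = [seq face_monomial F [set i in e] | e <- minimal_nonfaces].
Proof.
have vE k : (k < 8)%N -> inord k = vtx k.+1.
  by move=> k8; apply: val_inj; rewrite /= inordK // modn_small.
rewrite /K8_generators /= !vE //.
by rewrite !face_monomial_seq // !big_cons !big_nil !mulr1 !mulrA.
Qed.

(** If no generator divides the monomial of [s], then evaluation at the
    indicator function of [s] kills the ideal but not this monomial. *)
Lemma mem_K8 (s : {set 'I_8}) : (s \in K8 F) = is_face (mem s).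
Proof.
rewrite inE; apply/idP/idP => [|/allP sf].
  apply: contraR => /allPn[e eN]; rewrite negbK => /allP es.
  have ge : face_monomial F [set i in e] \in K8_generators F.
    by rewrite K8_generatorsE; apply/mapP; exists e.
  rewrite /face_monomial (big_setID [set i in e]) /=; apply: ideal_gen_mulr.
  have -> : s :&: [set i in e] = [set i in e].
    by apply/setIidPr/subsetP=> i; rewrite inE => /es.
  exact: ideal_gen_sub.
pose chi (i : 'I_8) : F := (i \in s)%:R.
apply/negP=> /ideal_genP; set p := face_monomial F s => sI.
have chi_p : p.@[chi] = 1.
  by rewrite /p rmorph_prod /= big1 // => i si; rewrite mevalXU /chi si.
have : p.@[chi] = 0.
  elim: sI => [|a g b x]; first exact: meval0.
  rewrite K8_generatorsE => /mapP[e /sf /allPn[i ie /negbTE is'] ->] _ IHx.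
  have {}is' : (i \in s) = false by [].
  rewrite mevalD IHx !mevalM addr0 /face_monomial rmorph_prod (bigD1 i) ?inE //=.
  by rewrite mevalXU /chi is' mul0r mulr0 mul0r.
by rewrite chi_p => /eqP; rewrite oner_eq0.
Qed.

Lemma dual_set0 : set0 \in alexander_dual (K8 F).
Proof.
apply/imsetP; exists setT; last by rewrite setCT.
by rewrite inE mem_K8; apply/allPn; exists [:: vtx 1; vtx 2]; rewrite //= !inE.
Qed.

(** The full subcomplex of the Bier sphere on the first copy of the vertex set
    is [K]: the empty set is in the dual. *)
Lemma mem_bier_lshift (s : {set 'I_8}) :
  (lshift 8 @: s \in bier (K8 F)) = (s \in K8 F).
Proof.
apply/imset2P/idP => [[s' t s'K _ eq_s]|sK]; last first.
  exists s set0 => //; first by rewrite inE dual_set0 -setI_eq0 setI0 eqxx.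
  by rewrite imset0 setU0.
suff -> : s = s' by [].
apply/setP=> i; rewrite -!(mem_imset _ _ (@lshift_inj 8 8)) eq_s inE orbC.
case: imsetP => // -[j _ /eqP].
by rewrite eq_lrshift.
Qed.

Lemma face_word_lshift (s c : seq 'I_8) : uniq s -> ~~ has (mem s) c ->
  is_face (mem s) -> face_word (bier (K8 F)) (map (lshift 8) s) (map (lshift 8) c).
Proof.
move=> us sc sf; split.
- by rewrite map_inj_uniq //; exact: lshift_inj.
- move=> _ /mapP[i ic ->]; rewrite mem_map; last exact: lshift_inj.
  by apply: contra sc => si; apply/hasP; exists i.
move=> t ts; have -> : t = lshift 8 @: (lshift 8 @^-1: t).
  apply/setP=> x; apply/idP/imsetP => [xt|[i]]; last by rewrite inE => ? ->.
  have /mapP[i _ xi] := subsetP ts x xt.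
  by exists i; rewrite // inE -xi.
rewrite mem_bier_lshift mem_K8; apply: is_faceS sf => i; rewrite !inE => /(subsetP ts).
by rewrite mem_map //; exact: lshift_inj.
Qed.

Lemma vertex_face (i : 'I_8) : [set i] \in K8 F.
Proof.
rewrite mem_K8; have : is_face (pred1 i).
  by case: i => -[|[|[|[|[|[|[|[|//]]]]]]]] ?; vm_compute.
by apply: is_faceS => j; rewrite !inE.
Qed.

Lemma vertex_dual (i : 'I_8) : [set i] \in alexander_dual (K8 F).
Proof.
apply/imsetP; exists (~: [set i]); last by rewrite setCK.
rewrite inE mem_K8; have : ~~ is_face (predC1 i).
  by case: i => -[|[|[|[|[|[|[|[|//]]]]]]]] ?; vm_compute.
by apply: contra; apply: is_faceS => j; rewrite !inE.
Qed.

Lemma card_vertices_K8 : #|vertices (K8 F)| = 8%N.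
Proof.
have -> : vertices (K8 F) = setT by apply/setP=> i; rewrite [LHS]inE vertex_face inE.
by rewrite cardsT card_ord.
Qed.

Lemma card_vertices_bier : #|vertices (bier (K8 F))| = 16%N.
Proof.
have -> : vertices (bier (K8 F)) = setT; last by rewrite cardsT card_ord.
apply/setP=> x; rewrite [LHS]inE [RHS]inE -(splitK x); case: (split x) => i /=.
  by rewrite -imset_set1 mem_bier_lshift vertex_face.
apply/imset2P; exists set0 [set i]; rewrite ?mem_K8 //=.
- by apply/allP=> e; rewrite !inE => /or4P[||| /orP[]] /eqP->; rewrite /= !inE.
- by rewrite inE vertex_dual -setI_eq0 set0I eqxx.
- by rewrite imset0 set0U imset_set1.
Qed.

End Complex.

(** * A functional that kills products of cocycles *)

Definition bier_vtx (k : nat) : 'I_(8 + 8) := lshift 8 (vtx k).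

Definition face_check (s c : seq nat) : bool :=
  let s' := map vtx s in
  [&& uniq s', ~~ has (mem s') (map vtx c) & is_face (mem s')].

(** Evaluation at words in the labels of the first copy of the vertex set. It is
    locked so that unification never unfolds the iterated derivations. *)
HB.lock Definition bier_ev (F : fieldType) (s c : seq nat) (f : koszul F (8 + 8)) : F :=
  ev (map bier_vtx s) (map bier_vtx c) f.
Canonical bier_ev_unlockable := Unlockable bier_ev.unlock.

Section Detector.
Variable F : fieldType.
Local Notation K := (bier (K8 F)).
Local Notation I := (in_ideal (@cw_relation F (8 + 8) K)).
Implicit Types (f g r : koszul F (8 + 8)) (s c : seq nat) (i j k : nat).

Lemma bier_ev_is_zmod_morphism s c : zmod_morphism (@bier_ev F s c).
Proof. by move=> f g; rewrite unlock raddfB. Qed.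
HB.instance Definition _ s c :=
  GRing.isZmodMorphism.Build _ _ (@bier_ev F s c) (bier_ev_is_zmod_morphism s c).

Lemma bier_ev_face s c f : face_check s c -> I f -> bier_ev s c f = 0.
Proof.
rewrite unlock => /and3P[us sc sf]; apply: ev_ideal.
by have := face_word_lshift F us sc sf; rewrite -!map_comp.
Qed.

Lemma bier_ev_cons k s c f : bier_ev (k :: s) c f = bier_ev s c (ddx (bier_vtx k) f).
Proof. by rewrite unlock. Qed.

Lemma bier_ev_nil_diff c f : bier_ev [::] c (koszul_diff f) = 0.
Proof. by rewrite unlock; exact: ev_nil_diff. Qed.

Lemma bier_ev_cons_diff k s c f : bier_ev (k :: s) c (koszul_diff f) =
  bier_ev s (k :: c) f + bier_ev s c (koszul_diff (ddx (bier_vtx k) f)).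
Proof. by rewrite unlock; exact: ev_cons_diff. Qed.

Lemma bier_ev_swap s j k c f : bier_ev s (j :: k :: c) f = - bier_ev s (k :: j :: c) f.
Proof. by rewrite unlock; exact: ev_swap. Qed.

(** The empty simplex is the boundary of the vertex [k], and cocycles vanish on
    boundaries. *)
Lemma cocycle_point g k c : I (koszul_diff g) -> face_check [:: k] c ->
  bier_ev [::] (k :: c) g = 0.
Proof.
by move=> dgI /bier_ev_face/(_ dgI); rewrite bier_ev_cons_diff bier_ev_nil_diff addr0.
Qed.

(** The difference of the vertices [i] and [j] is the boundary of the path
    through [k], even if [i] and [j] are not joined by an edge. *)
Lemma cocycle_cone g i j k c : I (koszul_diff g) ->
    face_check [:: i; k] (j :: c) -> face_check [:: j; k] (i :: c) ->
  bier_ev [:: i] (j :: k :: c) g + bier_ev [:: j] (i :: k :: c) g = 0.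
Proof.
move=> dgI /bier_ev_face/(_ dgI); rewrite !bier_ev_cons_diff bier_ev_nil_diff -!bier_ev_cons addr0.
rewrite -[bier_ev [:: i] _ _]opprK -bier_ev_swap => /eqP; rewrite subr_eq0 => /eqP <-.
move=> /bier_ev_face/(_ dgI); rewrite !bier_ev_cons_diff bier_ev_nil_diff -!bier_ev_cons addr0.
rewrite -[bier_ev [:: j] _ _]opprK -bier_ev_swap => /eqP; rewrite subr_eq0 => /eqP <-.
by rewrite bier_ev_swap addNr.
Qed.

(** The boundary of the cone over 1345 with apex [k] consists of 1345 and of
    four simplices on which the relation [r] vanishes. *)
Lemma relation_cone r k c : I r -> koszul_diff r = 0 ->
    face_check [:: 3; 4; 5; k]%N (1%N :: c) -> face_check [:: 1; 4; 5; k]%N (3%N :: c) ->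
    face_check [:: 1; 3; 5; k]%N (4%N :: c) -> face_check [:: 1; 3; 4; k]%N (5%N :: c) ->
  bier_ev [:: 1; 3; 4; 5]%N (k :: c) r = 0.
Proof.
move=> rI dr f1 f3 f4 f5.
have: bier_ev [:: 1; 3; 4; 5; k]%N c (koszul_diff r) = 0 by rewrite dr raddf0.
rewrite !bier_ev_cons_diff bier_ev_nil_diff -!bier_ev_cons.
by rewrite (bier_ev_face f1 rI) (bier_ev_face f3 rI) (bier_ev_face f4 rI)
  (bier_ev_face f5 rI) !add0r addr0.
Qed.

(** In the full subcomplex on {1,...,6}, the cone over 1345 with apex 6 also has
    the face 3456, which is not a simplex of [K]; the value of [r] at 3456 is
    in turn zero by the cone over it with apex 2. *)
Lemma relation_two_cones r : I r -> koszul_diff r = 0 ->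
  bier_ev [:: 1; 3; 4; 5]%N [:: 2; 6]%N r = 0.
Proof.
move=> rI dr; rewrite bier_ev_swap.
have: bier_ev [:: 1; 3; 4; 5; 6]%N [:: 2]%N (koszul_diff r) = 0 by rewrite dr raddf0.
have: bier_ev [:: 2; 3; 4; 5; 6]%N [:: 1]%N (koszul_diff r) = 0 by rewrite dr raddf0.
rewrite !bier_ev_cons_diff !bier_ev_nil_diff -!bier_ev_cons.
have face0 s c : face_check s c -> bier_ev s c r = 0 by move/bier_ev_face; exact.
rewrite (face0 [:: 2; 4; 5; 6]%N) // (face0 [:: 2; 3; 5; 6]%N) //.
rewrite (face0 [:: 2; 3; 4; 6]%N) // (face0 [:: 2; 3; 4; 5]%N) // !addr0.
rewrite bier_ev_swap => /eqP; rewrite oppr_eq0 => /eqP ->.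
rewrite (face0 [:: 1; 4; 5; 6]%N) // (face0 [:: 1; 3; 5; 6]%N) //.
by rewrite (face0 [:: 1; 3; 4; 6]%N) // !add0r => ->; rewrite oppr0.
Qed.

(** Evaluation on the two 4-simplices that contain 1345, with opposite
    orientations: 7 and 8 are exchanged. *)
Definition chain f : F :=
  bier_ev [:: 8; 1; 3; 4; 5]%N [:: 7; 2; 6]%N f +
  bier_ev [:: 7; 1; 3; 4; 5]%N [:: 8; 2; 6]%N f.

Lemma chain_is_zmod_morphism : zmod_morphism chain.
Proof.
by move=> f g; rewrite /chain !raddfB /= opprD; exact: addrACA.
Qed.
HB.instance Definition _ := GRing.isZmodMorphism.Build _ _ chain
  chain_is_zmod_morphism.

(** The term of the Leibniz rule in which [a] and [b] select the letters that
    act on the left factor; [i] and [j] are 7 and 8 in one of the two orders. *)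
Definition split_ev (a b : bitseq) i j r g : F :=
  bier_ev (mask a [:: i; 1; 3; 4; 5]%N) (mask b [:: j; 2; 6]%N) r *
  bier_ev (mask (map negb a) [:: i; 1; 3; 4; 5]%N) (mask (map negb b) [:: j; 2; 6]%N) g.

(** The two simplices of [chain] are treated together: when 7 and 8 both fall
    on [g], only the sum of their contributions vanishes. *)
Lemma split_ev_eq0 r g a b : I r -> koszul_diff r = 0 ->
    I (koszul_diff g) -> augmentation g = 0 -> size a = 5%N -> size b = 3%N ->
  split_ev a b 8 7 r g + split_ev a b 7 8 r g = 0.
Proof.
move=> rI dr dgI g0.
case: a => [|a0 [|a1 [|a2 [|a3 [|a4 [|//]]]]]] // _.
case: b => [|b0 [|b1 [|b2 [|//]]]] // _.
have [fa|] := boolP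
    (face_check (mask [:: a0; a1; a2; a3; a4] [:: 8; 1; 3; 4; 5])
                (mask [:: b0; b1; b2] [:: 7; 2; 6]) &&
     face_check (mask [:: a0; a1; a2; a3; a4] [:: 7; 1; 3; 4; 5])
                (mask [:: b0; b1; b2] [:: 8; 2; 6]))%N.
  case/andP: fa => fa8 fa7; rewrite /split_ev.
  by rewrite (bier_ev_face fa8 rI) (bier_ev_face fa7 rI) !mul0r addr0.
rewrite /split_ev => nf.
(* A proper part of 1345 spans a simplex with 7 and with 8, so [r] has to
   receive 1345 entirely. *)
have [-> -> -> ->] : [/\ a1, a2, a3 & a4].
  by move: nf; case: a1; case: a2; case: a3; case: a4 => //; case: a0; case: b0;
    case: b1; case: b2; vm_compute.
(* The fifth vertex of the simplex falls on [r]: then [g] receives only odd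
   derivations, so it is evaluated at the empty simplex. *)
case: a0 {nf} => /=.
  have gpts c : (if c is k :: c' then face_check [:: k] c' else true) ->
      bier_ev [::] c g = 0.
    by case: c => [|k c] fc; [rewrite unlock | exact: cocycle_point].
  rewrite !gpts ?mulr0 ?addr0 //; by case: b0; case: b1; case: b2; vm_compute.
case: b0 => /=.
  (* The fifth vertex falls on [g], but the odd derivation at the other one of
     7 and 8 falls on [r], which leaves room for the cone with this apex. *)
  by case: b1; case: b2; rewrite /= !(relation_cone rI dr) // !mul0r addr0.
(* Both 7 and 8 fall on [g]. If neither 2 nor 6 does, then [r] is evaluated
   at 1345 in the full subcomplex on {1,...,6}; otherwise 2 or 6 joins 7 to 8. *)
rewrite -mulrDr; have [/andP[-> ->]|nb] := boolP (b1 && b2).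
  by rewrite /= relation_two_cones // mul0r.
have cone k c : face_check [:: 8; k] (7 :: c) -> face_check [:: 7; k] (8 :: c) ->
    bier_ev [:: 8] (7 :: k :: c) g + bier_ev [:: 7] (8 :: k :: c) g = 0.
  exact: cocycle_cone.
by case: b1 b2 nb => [] [] //= _; rewrite cone // mulr0.
Qed.

Lemma chainM_split f g : chain (f * g) =
  \sum_(a <- masks 5) \sum_(b <- masks 3)
    mask_sign b * (split_ev a b 8 7 f g + split_ev a b 7 8 f g).
Proof.
rewrite /chain unlock !ev_mul -big_split /=; apply: eq_bigr => a _.
rewrite -big_split /=; apply: eq_bigr => b _.
by rewrite -mulrDr /split_ev unlock !map_mask.
Qed.

Lemma chain_relationM r g : I r -> koszul_diff r = 0 ->
  I (koszul_diff g) -> augmentation g = 0 -> chain (r * g) = 0.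
Proof.
move=> rI dr dgI g0; rewrite chainM_split big_seq big1 // => a /size_masks sa.
by rewrite big_seq big1 // => b /size_masks sb; rewrite split_ev_eq0 ?mulr0.
Qed.

Lemma chain_Mrelation r g : I r -> koszul_diff r = 0 ->
  I (koszul_diff g) -> augmentation g = 0 -> chain (g * r) = 0.
Proof.
move=> rI dr dgI g0; rewrite chainM_split big_seq big1 // => a /size_masks sa.
rewrite big_seq big1 // => b /size_masks sb.
have negK l : map negb (map negb l) = l by rewrite mapK //; exact: negbK.
have split_swap i j : split_ev a b i j g r = split_ev (map negb a) (map negb b) i j r g.
  by rewrite /split_ev !negK mulrC.
by rewrite !split_swap split_ev_eq0 ?size_map // mulr0.
Qed.

(** Evaluation on the 3-cycle that is the boundary of [chain]. *)
Definition detector f : F := chain (koszul_diff f).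

Lemma detector_is_zmod_morphism : zmod_morphism detector.
Proof. by move=> f g; rewrite /detector raddfB raddfB. Qed.
HB.instance Definition _ := GRing.isZmodMorphism.Build _ _ detector
  detector_is_zmod_morphism.

Lemma detector_diff f : detector (koszul_diff f) = 0.
Proof. by rewrite /detector koszul_diffK raddf0. Qed.

(** The face 1345 of the two simplices of [chain] occurs with opposite signs,
    and all other faces are simplices of [K]. *)
Lemma detector_ideal f : I f -> detector f = 0.
Proof.
move=> fI; have face0 s c : face_check s c -> bier_ev s c f = 0 by move/bier_ev_face; exact.
rewrite /detector /chain !bier_ev_cons_diff !bier_ev_nil_diff -!bier_ev_cons.
rewrite (face0 [:: 8; 3; 4; 5]%N) // (face0 [:: 8; 1; 4; 5]%N) //.
rewrite (face0 [:: 8; 1; 3; 5]%N) // (face0 [:: 8; 1; 3; 4]%N) //.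
rewrite (face0 [:: 7; 3; 4; 5]%N) // (face0 [:: 7; 1; 4; 5]%N) //.
rewrite (face0 [:: 7; 1; 3; 5]%N) // (face0 [:: 7; 1; 3; 4]%N) //.
by rewrite !addr0 bier_ev_swap addNr.
Qed.

(** The constant terms vanish for cochains of positive degree; without this
    hypothesis [f = 1] would be a counterexample. *)
Lemma detectorM p f g : koszul_hom p f ->
    I (koszul_diff f) -> I (koszul_diff g) -> augmentation f = 0 -> augmentation g = 0 ->
  detector (f * g) = 0.
Proof.
move=> hf dfI dgI f0 g0; rewrite /detector (koszul_diffM _ hf) raddfD /=.
rewrite chain_relationM ?koszul_diffK // add0r -signr_odd -mulrA mulr_sign.
by case: ifP => _; rewrite ?raddfN /= chain_Mrelation ?koszul_diffK ?oppr0.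
Qed.

Lemma bier_ev_xM0 s c k f : uniq (map bier_vtx s) -> bier_vtx k \notin map bier_vtx s ->
  bier_ev s c (koszul_x F (bier_vtx k) * f) = 0.
Proof. by rewrite unlock => us /negPf ks; rewrite ev_xM // ks. Qed.

Lemma bier_ev_xM k s c f : uniq (map bier_vtx (k :: s)) ->
  bier_ev (k :: s) c (koszul_x F (bier_vtx k) * f) = bier_ev s c f.
Proof. by rewrite unlock => us; rewrite ev_xM //= mem_head eqxx. Qed.

Lemma bier_ev_uM k c1 c2 f : bier_vtx k \notin map bier_vtx (c1 ++ c2) ->
  bier_ev [::] (c1 ++ k :: c2) (koszul_u F (bier_vtx k) * f) =
  (-1) ^+ size c1 * bier_ev [::] (c1 ++ c2) f.
Proof. by rewrite unlock !map_cat /= => kc; rewrite ev_uM // size_map. Qed.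

Definition bier_x k : koszul F (8 + 8) := koszul_x F (bier_vtx k).
Definition bier_u k : koszul F (8 + 8) := koszul_u F (bier_vtx k).

Lemma detector_monomial :
  detector (bier_x 7 * (bier_x 1 * (bier_x 3 * (bier_x 5 *
    (bier_u 2 * (bier_u 4 * (bier_u 6 * bier_u 8))))))) = -1.
Proof.
set f := bier_x 7 * _; rewrite /detector /chain !bier_ev_cons_diff.
rewrite !bier_ev_nil_diff -!bier_ev_cons !addr0.
have z7 s c : uniq (map bier_vtx s) -> bier_vtx 7 \notin map bier_vtx s -> bier_ev s c f = 0.
  exact: bier_ev_xM0.
rewrite (z7 [:: 8; 3; 4; 5]%N) // (z7 [:: 8; 1; 4; 5]%N) //.
rewrite (z7 [:: 8; 1; 3; 5]%N) // (z7 [:: 8; 1; 3; 4]%N) //.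
rewrite !(z7 [:: 1; 3; 4; 5]%N) // !addr0 !add0r /f /bier_x /bier_u {z7 f}.
rewrite !(bier_ev_xM (k := 7)) // (bier_ev_xM0 (s := [:: 3; 4; 5]%N)) //.
rewrite !(bier_ev_xM (k := 1)) // (bier_ev_xM0 (s := [:: 4; 5]%N)) //.
rewrite !(bier_ev_xM (k := 3)) // (bier_ev_xM0 (s := [:: 4]%N)) // !addr0 !add0r bier_ev_xM //.
rewrite -[koszul_u F (bier_vtx 8)]mulr1.
rewrite (@bier_ev_uM 2 [:: 4; 8] [:: 6]) // (@bier_ev_uM 4 [::] [:: 8; 6]) //.
rewrite (@bier_ev_uM 6 [:: 8] [::]) // (@bier_ev_uM 8 [::] [::]) // unlock ev_1.
by rewrite /=; ring.
Qed.

End Detector.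

(** * Massey triple products detected by a functional *)

Lemma coh_class_eq (A : dga) (z z' : cocycles A) : coh_class z = coh_class z' ->
  exists b, diff A b = cocycle_val z - cocycle_val z'.
Proof.
by move=> /quot_piP/coboundaryP[b zb]; exists b; rewrite -zb cocycle_valB.
Qed.

Section MasseyDetection.
Variables (A : dga) (F : fieldType) (phi : {additive A -> F}).
Hypothesis phi_diff : forall b, phi (diff A b) = 0.
Hypothesis phi_cocycleM : forall i j (u v : A), hom i.+1 u -> hom j.+1 v ->
  diff A u = 0 -> diff A v = 0 -> phi (u * v) = 0.

Lemma phi_sign k u : phi ((-1) ^+ k * u) = (-1) ^+ k * phi u.
Proof. by rewrite -signr_odd mulr_sign -signr_odd mulr_sign; case: ifP; rewrite ?raddfN. Qed.

Lemma phi_by_parts i (u v : A) : hom i u ->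
  phi (diff A u * v) = - ((-1) ^+ i * phi (u * diff A v)).
Proof.
move=> hu; apply/eqP; rewrite -addr_eq0 -phi_sign mulrA -raddfD.
by rewrite -(diffM _ hu) phi_diff.
Qed.

(** A change of representatives by coboundaries changes given primitives [x],
    [y] into [x1], [y1], and the cocycle by a coboundary, as integration by
    parts shows. Any other primitives [x'], [y'] differ from [x1], [y1] by
    cocycles of positive degree, which [phi] does not see after
    multiplication by [c'] and [a']. *)
Lemma massey_detected p q r (a b c a' b' c' : cocycles A) (x y x' y' : A) :
    hom p.+1 (cocycle_val a) -> hom q.+1 (cocycle_val b) -> hom r.+1 (cocycle_val c) ->
    hom p.+1 (cocycle_val a') -> hom q.+1 (cocycle_val b') ->
    hom r.+1 (cocycle_val c') ->
    coh_class a' = coh_class a -> coh_class b' = coh_class b ->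
    coh_class c' = coh_class c ->
    hom (p + q).+1 x -> diff A x = cocycle_val a * cocycle_val b ->
    hom (q + r).+1 y -> diff A y = cocycle_val b * cocycle_val c ->
    hom (p + q).+1 x' -> diff A x' = cocycle_val a' * cocycle_val b' ->
    hom (q + r).+1 y' -> diff A y' = cocycle_val b' * cocycle_val c' ->
  phi (x' * cocycle_val c' - (-1) ^+ p.+1 * cocycle_val a' * y') =
  phi (x * cocycle_val c - (-1) ^+ p.+1 * cocycle_val a * y).
Proof.
have prim i (z z' : cocycles A) : hom i.+1 (cocycle_val z) -> hom i.+1 (cocycle_val z') ->
    coh_class z' = coh_class z ->
    exists2 e, hom i e & cocycle_val z' = cocycle_val z + diff A e.
  move=> hz hz' /coh_class_eq[e0 /exact_hom_pred].
  move=> /(_ _ (homB hz' hz))[e he de]; exists e => //.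
  by rewrite de addrC subrK.
move=> ha hb hc ha' hb' hc' /(prim _ _ _ ha ha')[eA hA aE].
move=> /(prim _ _ _ hb hb')[eB hB bE] /(prim _ _ _ hc hc')[eC hC cE].
move: (cocyclesE a) (cocyclesE b) (cocyclesE c) (cocyclesE a') (cocyclesE b') (cocyclesE c').
move: ha hb hc ha' hb' hc' aE bE cE.
move: (cocycle_val a) (cocycle_val b) (cocycle_val c).
move: (cocycle_val a') (cocycle_val b') (cocycle_val c').
move=> {a b c a' b' c'} a' b' c' a b c ha hb hc ha' hb' hc' aE bE cE.
move=> da db dc da' db' dc' hx dx hy dy hx' dx' hy' dy'.
(* The primitives of [a' b'] and [b' c'] for the new representatives. *)
pose x1 := x + eA * b + (-1) ^+ p.+1 * (a' * eB).
pose y1 := y + eB * c + (-1) ^+ q.+1 * (b' * eC).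
have hx1 : hom (p + q).+1 x1.
  apply: homD; first by apply: homD => //; rewrite -addnS; exact: homM.
  by apply: hom_sign; rewrite -addSn; exact: homM.
have hy1 : hom (q + r).+1 y1.
  apply: homD; first by apply: homD => //; rewrite -addnS; exact: homM.
  by apply: hom_sign; rewrite -addSn; exact: homM.
have dx1 : diff A x1 = a' * b'.
  rewrite !raddfD /= diff_sign (diffM _ hA) (diffM _ ha') dx da' db mulr0 addr0 mul0r add0r.
  by rewrite -mulrA sign_signK -mulrDl -aE bE mulrDr.
have dy1 : diff A y1 = b' * c'.
  rewrite !raddfD /= diff_sign (diffM _ hB) (diffM _ hb') dy db' dc mulr0 addr0 mul0r add0r.
  by rewrite -mulrA sign_signK -mulrDl -bE cE mulrDr.
have x1x' : phi (x' * c') = phi (x1 * c').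
  apply/eqP; rewrite -subr_eq0 -raddfB -mulrBl; apply/eqP.
  by apply: phi_cocycleM (homB hx' hx1) hc' _ dc'; rewrite raddfB /= dx' dx1 subrr.
have y1y' : phi (a' * y') = phi (a' * y1).
  apply/eqP; rewrite -subr_eq0 -raddfB -mulrBr; apply/eqP.
  by apply: phi_cocycleM ha' (homB hy' hy1) da' _; rewrite raddfB /= dy' dy1 subrr.
have ebyA := phi_by_parts y hA; have ebyC := phi_by_parts eC hx1.
rewrite dy mulrA in ebyA; rewrite dx1 in ebyC.
rewrite !raddfB /= -!mulrA !phi_sign x1x' y1y'.
have -> : phi (x1 * c') =
    phi (x * c) + phi (eA * b * c) + (-1) ^+ p.+1 * phi (a' * eB * c) + phi (x1 * diff A eC).
  by rewrite cE mulrDr raddfD /= !mulrDl !raddfD /= -(mulrA (_ ^+ _)) phi_sign.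
have -> : phi (a' * y1) = phi (a * y) + phi (diff A eA * y) + phi (a' * eB * c) +
    (-1) ^+ q.+1 * phi (a' * b' * eC).
  rewrite -[phi (a * y) + _]raddfD -mulrDl -aE /y1 !mulrDr !raddfD /=.
  rewrite [a' * (eB * c)]mulrA; congr (_ + _).
  by rewrite mulrA commr_sign -mulrA phi_sign mulrA.
rewrite ebyA ebyC !exprS exprD -(signr_odd _ p) -(signr_odd _ q).
by case: (odd p); case: (odd q); rewrite /= ?expr0 ?expr1; ring.
Qed.

(** The value of [phi] on one element of the Massey product is its value on all
    of them, whereas it is zero on products of classes of positive degree. *)
Theorem massey_indecomposable p q r (a b c : cocycles A) (x y : A) :
    hom p.+1 (cocycle_val a) -> hom q.+1 (cocycle_val b) -> hom r.+1 (cocycle_val c) ->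
    hom (p + q).+1 x -> diff A x = cocycle_val a * cocycle_val b ->
    hom (q + r).+1 y -> diff A y = cocycle_val b * cocycle_val c ->
    phi (x * cocycle_val c - (-1) ^+ p.+1 * cocycle_val a * y) != 0 ->
  ~ decomposable (massey p.+1 q.+1 r.+1 (coh_class a) (coh_class b) (coh_class c)).
Proof.
move=> ha hb hc hx dx hy dy /eqP phi0 [lambda [nu [[m [f [hf lE]]] [n [g [hg nE]]]]]].
move=> [a' [b' [c' [x' [y' [z [[ha' hb' hc'] [aE bE cE] [hx' dx'] [hy' dy'] [zE zC]]]]]]]].
rewrite addSn addnS /= in hx'; rewrite addSn addnS /= in hy'.
apply: phi0; rewrite -(massey_detected ha hb hc ha' hb' hc' aE bE cE hx dx hy dy hx' dx' hy' dy').
rewrite -zE.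
pose zf i := s2val (cid2 (hf i)); pose zg i := s2val (cid2 (hg i)).
have zfE i : f i = coh_class (zf i) by exact: s2valP' (cid2 (hf i)).
have zgE i : g i = coh_class (zg i) by exact: s2valP' (cid2 (hg i)).
have /coh_class_eq[e] : coh_class z = coh_class ((\sum_(i < m) zf i) * \sum_(j < n) zg j).
  rewrite -zC lE nE /coh_class rmorphM !raddf_sum.
  by congr (_ * _); apply: eq_bigr => i _; rewrite ?zfE ?zgE.
move=> /(congr1 phi)/esym/eqP; rewrite phi_diff raddfB subr_eq0 => /eqP ->.
have sum_val k (h : nat -> cocycles A) :
    cocycle_val (\sum_(i < k) h i) = \sum_(i < k) cocycle_val (h i).
  exact: (raddf_sum (val : cocycles A -> A)).
rewrite cocycle_valM !sum_val mulr_suml raddf_sum big1 // => i _.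
rewrite mulr_sumr raddf_sum big1 // => j _.
by apply: (phi_cocycleM (s2valP (cid2 (hf i))) (s2valP (cid2 (hg j)))); exact: cocyclesE.
Qed.
End MasseyDetection.

(** * The Massey triple product *)

Section QuotientLift.
Variables (R : pzRingType) (J : biideal R) (V : zmodType) (phi : {additive R -> V}).
Hypothesis phiJ : forall x, x \in (J : {pred R}) -> phi x = 0.

Definition quot_lift (q : ring_quot J) : V := phi (sval (quot_pi_surj q)).

Lemma quot_liftE x : quot_lift (quot_pi J x) = phi x.
Proof.
rewrite /quot_lift; case: quot_pi_surj => y /= /quot_piP/phiJ/eqP.
by rewrite raddfB subr_eq0 => /eqP.
Qed.

Lemma quot_lift_is_zmod_morphism : zmod_morphism quot_lift.
Proof.
move=> p q; case: (quot_pi_surj p) (quot_pi_surj q) => x <- [y <-].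
by rewrite -raddfB !quot_liftE raddfB.
Qed.
HB.instance Definition _ := GRing.isZmodMorphism.Build _ _ quot_lift
  quot_lift_is_zmod_morphism.

End QuotientLift.

(** The identities between monomials are proved in an arbitrary ring, where
    rewriting does not unfold the operations of the cochain algebra. *)
Section KoszulIdentities.
Variables (R : pzRingType) (x u : nat -> R) (d : {additive R -> R}).
Hypothesis xC : forall k f, f * x k = x k * f.
Hypothesis dxM : forall k f, d (x k * f) = x k * d f.
Hypothesis duM : forall k f, d (u k * f) = x k * f - u k * d f.
Hypothesis du : forall k, d (u k) = x k.

Let uxCA i k f : u i * (x k * f) = x k * (u i * f).
Proof. by rewrite mulrA xC -mulrA. Qed.

Let uxC i k : u i * x k = x k * u i.
Proof. exact: xC. Qed.

Lemma alpha_beta_eq0 : x 1 * (x 3 * (x 4 * x 5)) = 0 ->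
  x 1 * u 2 * (x 3 * (x 4 * (x 5 * u 6))) = 0.
Proof.
move=> n1345; transitivity (x 1 * (x 3 * (x 4 * x 5)) * (u 2 * u 6)).
  by rewrite -!mulrA !uxCA.
by rewrite n1345 mul0r.
Qed.

(** In the quotient, moving the variable from 6 to 4 in the class of
    [x_3 x_4 x_5 u_6] costs [d (x_3 x_5 u_4 u_6)], and the new representative
    multiplied by [x_7 u_8] contains the relation [x_3 x_5 x_6 x_7]. *)
Lemma diff_primitive_eq : x 3 * (x 5 * (x 6 * x 7)) = 0 -> x 7 * x 8 = 0 ->
  d (x 3 * (x 5 * (u 4 * (u 6 * (x 7 * u 8))))) =
  x 3 * (x 4 * (x 5 * u 6)) * (x 7 * u 8).
Proof.
move=> n3567 n78.
rewrite !(dxM, duM) du n78 !mulr0 subr0 mulrBr mulrBr.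
have -> : x 3 * (x 5 * (u 4 * (x 6 * (x 7 * u 8)))) = x 3 * (x 5 * (x 6 * x 7)) * (u 4 * u 8).
  by rewrite -!mulrA !uxCA.
rewrite n3567 mul0r subr0 -!mulrA !uxCA.
by congr (_ * _); rewrite [LHS]mulrA (xC 4) -mulrA.
Qed.

Lemma alpha_primitive_eq :
  x 1 * u 2 * (x 3 * (x 5 * (u 4 * (u 6 * (x 7 * u 8))))) =
  x 7 * (x 1 * (x 3 * (x 5 * (u 2 * (u 4 * (u 6 * u 8)))))).
Proof.
have xCA i k f : x i * (x k * f) = x k * (x i * f) by rewrite mulrA xC -mulrA.
by rewrite -!mulrA !uxCA [x 5 * (x 7 * _)]xCA [x 3 * (x 7 * _)]xCA [x 1 * (x 7 * _)]xCA.
Qed.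
End KoszulIdentities.

Section MasseyTriple.
Variable F : fieldType.
Local Notation K := (bier (K8 F)).
Local Notation A := (cw_cochains F K).
Local Notation J :=
  (@quot_ideal (koszul_dga F (8 + 8)) (@cw_relation F (8 + 8) K)).
Local Notation pi := (quot_pi J).

Lemma detector_quot f : f \in (J : {pred _}) -> detector f = 0.
Proof. by move/quot_idealP; exact: detector_ideal. Qed.

Definition class_detector : A -> F := @quot_lift _ J _ (@detector F).
HB.instance Definition _ := GRing.isZmodMorphism.Build A F class_detector
  (@quot_lift_is_zmod_morphism _ J _ _ detector_quot).

Lemma class_detectorE f : class_detector (pi f) = detector f.
Proof. exact: (quot_liftE detector_quot). Qed.

Lemma diff_pi f : diff A (pi f) = pi (koszul_diff f).
Proof.
exact: (quot_diffE (@cw_relation_hom F (8 + 8) K) (@cw_relation_diff F (8 + 8) K)).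
Qed.

Lemma class_detector_diff (b : A) : class_detector (diff A b) = 0.
Proof.
case: (quot_pi_surj b) => f <-.
by rewrite diff_pi class_detectorE detector_diff.
Qed.

Lemma pi_eq0 f : pi f = 0 -> in_ideal (cw_relation K) f.
Proof.
by rewrite -(raddf0 pi) => /quot_piP; rewrite subr0 => /quot_idealP.
Qed.

(** The constant term lies in degree 0. *)
Lemma augmentation_pos n k (f : koszul F n) : koszul_hom k.+1 f -> augmentation f = 0.
Proof.
move=> hf; apply/eqP; apply/negPn/negP=> /(koszul_hom_coeff hf).
by rewrite mdeg0 cards0.
Qed.

Lemma class_detector_cocycleM i j (u v : A) : hom i.+1 u -> hom j.+1 v ->
  diff A u = 0 -> diff A v = 0 -> class_detector (u * v) = 0.
Proof.
move=> [f hf ->] [g hg ->]; rewrite !diff_pi => /pi_eq0 dfI /pi_eq0 dgI.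
rewrite -rmorphM class_detectorE.
exact: detectorM hf dfI dgI (augmentation_pos hf) (augmentation_pos hg).
Qed.

Definition coch_x k : A := pi (bier_x F k).
Definition coch_u k : A := pi (bier_u F k).

Lemma hom_coch_x k : hom 2 (coch_x k).
Proof. by exists (koszul_x F (bier_vtx k)) => //; exact: koszul_x_hom. Qed.

Lemma hom_coch_u k : hom 1 (coch_u k).
Proof. by exists (koszul_u F (bier_vtx k)) => //; exact: koszul_u_hom. Qed.

Lemma coch_xC k (f : A) : f * coch_x k = coch_x k * f.
Proof.
by case: (quot_pi_surj f) => g <-; rewrite -!rmorphM koszul_xC.
Qed.

Lemma diff_coch_xM k (f : A) : diff A (coch_x k * f) = coch_x k * diff A f.
Proof.
case: (quot_pi_surj f) => g <-; rewrite diff_pi -!rmorphM diff_pi.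
by rewrite koszul_diff_constM.
Qed.

Lemma diff_coch_uM k (f : A) : diff A (coch_u k * f) = coch_x k * f - coch_u k * diff A f.
Proof.
case: (quot_pi_surj f) => g <-; rewrite diff_pi -!rmorphM diff_pi.
by rewrite koszul_diff_genM raddfB.
Qed.

Lemma diff_coch_u k : diff A (coch_u k) = coch_x k.
Proof. by rewrite -[coch_u k]mulr1 diff_coch_uM mulr1 diff1 mulr0 subr0. Qed.

Lemma nonface_prod (s : seq nat) : uniq (map vtx s) -> ~~ is_face (mem (map vtx s)) ->
  \prod_(k <- s) coch_x k = 0.
Proof.
move=> us sN.
have -> : \prod_(k <- s) coch_x k = pi (\prod_(i <- map bier_vtx s) koszul_x F i).
  by rewrite rmorph_prod big_map.
rewrite -(raddf0 pi); apply/quot_piP; rewrite subr0; apply/quot_idealP.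
have ub : uniq (map bier_vtx s).
  by rewrite (map_comp (lshift 8) vtx) map_inj_uniq //; exact: lshift_inj.
rewrite -ext_const_prod -face_monomial_seq //.
apply/ideal_genP/ideal_gen_sub/cw_nonface.
have -> : [set i in map bier_vtx s] = lshift 8 @: [set i in map vtx s].
  apply/setP=> i; rewrite inE (map_comp (lshift 8) vtx).
  by apply/mapP/imsetP => -[j js ->]; exists j; rewrite ?inE // inE in js *.
rewrite mem_bier_lshift mem_K8; apply: contra sN; apply: is_faceS => i.
by rewrite !inE.
Qed.


Definition alpha_rep : A := coch_x 1 * coch_u 2.
Definition beta_rep : A := coch_x 3 * (coch_x 4 * (coch_x 5 * coch_u 6)).
Definition gamma_rep : A := coch_x 7 * coch_u 8.
Definition primitive : A :=
  coch_x 3 * (coch_x 5 * (coch_u 4 * (coch_u 6 * (coch_x 7 * coch_u 8)))).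

Lemma alpha_cocycle : cocycle alpha_rep.
Proof.
apply/eqP; rewrite diff_coch_xM diff_coch_u.
by have := @nonface_prod [:: 1; 2]%N isT isT; rewrite !big_cons big_nil mulr1.
Qed.

Lemma gamma_cocycle : cocycle gamma_rep.
Proof.
apply/eqP; rewrite diff_coch_xM diff_coch_u.
by have := @nonface_prod [:: 7; 8]%N isT isT; rewrite !big_cons big_nil mulr1.
Qed.

Lemma beta_cocycle : cocycle beta_rep.
Proof.
apply/eqP; rewrite !diff_coch_xM diff_coch_u.
by have := @nonface_prod [:: 3; 4; 5; 6]%N isT isT; rewrite !big_cons big_nil mulr1.
Qed.


Lemma alpha_beta : alpha_rep * beta_rep = 0.
Proof.
have := @nonface_prod [:: 1; 3; 4; 5]%N isT isT.
rewrite !big_cons big_nil mulr1.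
exact: (alpha_beta_eq0 coch_u coch_xC).
Qed.

Lemma diff_primitive : diff A primitive = beta_rep * gamma_rep.
Proof.
have := @nonface_prod [:: 7; 8]%N isT isT.
have := @nonface_prod [:: 3; 5; 6; 7]%N isT isT.
rewrite !big_cons !big_nil !mulr1.
exact: (diff_primitive_eq coch_xC diff_coch_xM diff_coch_uM diff_coch_u).
Qed.

Lemma class_detector_massey : class_detector
  (0 * gamma_rep - (-1) ^+ 3 * alpha_rep * primitive) != 0.
Proof.
have -> : 0 * gamma_rep - (-1) ^+ 3 * alpha_rep * primitive = alpha_rep * primitive.
  by rewrite mul0r sub0r -signr_odd /= expr1 mulN1r mulNr opprK.
rewrite (alpha_primitive_eq coch_u coch_xC); have := detector_monomial F.
by rewrite -class_detectorE !rmorphM => ->; rewrite oppr_eq0 oner_eq0.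
Qed.

Lemma hom_alpha : hom 3 alpha_rep.
Proof. exact: homM (hom_coch_x 1) (hom_coch_u 2). Qed.

Lemma hom_beta : hom 7 beta_rep.
Proof.
exact: homM (hom_coch_x 3) (homM (hom_coch_x 4) (homM (hom_coch_x 5) (hom_coch_u 6))).
Qed.

Lemma hom_gamma : hom 3 gamma_rep.
Proof. exact: homM (hom_coch_x 7) (hom_coch_u 8). Qed.

Lemma hom_primitive : hom 9 primitive.
Proof.
apply: homM (hom_coch_x 3) (homM (hom_coch_x 5) (homM (hom_coch_u 4) (homM (hom_coch_u 6) _))).
exact: homM (hom_coch_x 7) (hom_coch_u 8).
Qed.

End MasseyTriple.

Theorem mainTheorem9 (F : fieldType) (charF0 : [pchar F] =i pred0) :
  [/\ #|vertices (K8 F)| = 8%N, #|vertices (bier (K8 F))| = 16%N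
    & exists (p q r : nat)
        (alpha beta gamma : cohomology (cw_cochains F (bier (K8 F)))),
        [/\ [/\ coh_hom p alpha, coh_hom q beta & coh_hom r gamma],
            alpha * beta = 0, beta * gamma = 0, (p + q + r).-1 = 12%N
          & ~ decomposable (massey p q r alpha beta gamma)]].
Proof.
split; [exact: card_vertices_K8 | exact: card_vertices_bier |].
pose a := Cocycles (@alpha_cocycle F); pose b := Cocycles (@beta_cocycle F).
pose c := Cocycles (@gamma_cocycle F).
have prod0 (z z' : cocycles (cw_cochains F (bier (K8 F)))) e :
    cocycle_val z * cocycle_val z' = diff _ e -> coh_class z * coh_class z' = 0.
  move=> zz'; rewrite /coh_class -rmorphM -(raddf0 (quot_pi (coboundaries _))).
  by apply/quot_piP; rewrite subr0; apply/coboundaryP; exists e; rewrite cocycle_valM.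
exists 3, 7, 3, (coh_class a), (coh_class b), (coh_class c); split=> //.
- split; [exists a | exists b | exists c] => //; [exact: hom_alpha | exact: hom_beta |].
  exact: hom_gamma.
- by apply: (@prod0 a b 0); rewrite raddf0; exact: alpha_beta.
- by apply: (@prod0 b c (primitive F)); rewrite diff_primitive.
apply: (@massey_indecomposable _ _ (@class_detector F) (@class_detector_diff F)
  (@class_detector_cocycleM F) 2 6 2 a b c 0 (primitive F)).
- exact: hom_alpha.
- exact: hom_beta.
- exact: hom_gamma.
- exact: hom0.
- by rewrite raddf0; exact/esym/alpha_beta.
- exact: hom_primitive.
- exact: diff_primitive.
- exact: class_detector_massey.
Qed.
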